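(* Let $g:\mathbb{R}\to\mathbb{R}$ be Lipschitz continuous, $\mathbb{Z}$-periodic and such that $g(y)>0$ for every $y$. For every $p\in\mathbb{R}^n$ there exists a unique constant $\bar c(|p|)$ such that there exists a monotone increasing solution $\chi=\chi_p$ to $$\chi''(z)|p|^2-\bar c(|p|)\chi'(z)+g(\chi(z))=0\ \text{ for }z\in(0,1),\qquad\chi(1)=\chi(0)+1,\qquad\chi'(0)=\chi'(1),$$ which is also unique up to horizontal translations. Moreover, the map $|p|\mapsto\bar c(|p|)$ is continuous, increasing and positive, and $$\bar c(|p|)=\begin{cases}\displaystyle\int_0^1 g(\chi_p(z))\,dz=\frac{\int_0^1 g(s)\,ds}{\int_0^1(\chi_p'(z))^2\,dz}& p\ne0,\\[2mm] \displaystyle\left(\int_0^1\frac1{g(s)}\,ds\right)^{-1}& p=0.\end{cases}$$ In particular $$\lim_{|p|\to0}\bar c(|p|)=\left(\int_0^1\frac1{g(s)}\,ds\right)^{-1}\quad\text{and}\quad\lim_{|p|\to0}\chi_p(z)=\chi_0(z)\ \text{ in }C(\mathbb{R}),$$ $$\lim_{|p|\to+\infty}\bar c(|p|)=\int_0^1 g(s)\,ds\quad\text{and}\quad\lim_{|p|\to+\infty}\chi_p(z)=z\ \text{ in }C^1(\mathbb{R}),$$ with $\bar c(|p|)<\int_0^1 g(s)\,ds$ if $g$ is nonconstant.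
   Context: Solutions are extended to all of $\mathbb{R}$ by $\chi(z+1)=\chi(z)+1$. A horizontal translation of $\chi$ is $z\mapsto\chi(z+k)$, $k\in\mathbb{R}$. The function $\chi_0$ is $\chi_p$ for $p=0$, in which case the equation is the first order equation $\bar c(0)\chi'(z)=g(\chi(z))$. Convergence in $C(\mathbb{R})$ (resp. $C^1(\mathbb{R})$) means that the difference (resp. the difference and its first derivative) tends to $0$ uniformly on $\mathbb{R}$. *)

(* Defs.v *)
From mathcomp Require Import all_boot all_order all_algebra.
From mathcomp Require Import all_classical all_reals all_analysis.

Set Implicit Arguments.
Unset Strict Implicit.
Unset Printing Implicit Defensive.

Import Order.TTheory GRing.Theory Num.Theory.
Import numFieldNormedType.Exports.

Local Open Scope classical_set_scope.
Local Open Scope ring_scope.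

(* The library norm on row vectors is the sup norm; this is the Euclidean one. *)
Definition enorm (R : realType) (n : nat) (p : 'rV[R]_n) : R :=
  Num.sqrt (\sum_i p ord0 i ^+ 2).

(* The filter on p obtained by letting |p| follow the filter F: for F = 0^'+
   it expresses |p| -> 0 and for F = +oo it expresses |p| -> +oo. *)
Definition enorm_to (R : realType) (n : nat) (F : set_system R) :
    set_system 'rV[R]_n :=
  [set A | \forall r \near F, forall p : 'rV[R]_n, enorm p = r -> A p].

(* When p = 0 the second-derivative term is multiplied by 0, so the equation is
   c chi' = g(chi) and only one derivative is required. The derivatives at the
   endpoints 0 and 1 are one-sided. *)
Definition solves_bvp (R : realType) (n : nat) (g : R -> R) (p : 'rV[R]_n)
    (c : R) (chi : R -> R) : Prop :=
  [/\ forall z : R, z \in `]0, 1[ ->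
        [/\ derivable chi z 1,
            p != 0 -> derivable (derive1 chi) z 1 &
            derive1 (derive1 chi) z * enorm p ^+ 2 - c * derive1 chi z + g (chi z) = 0],
      chi 1 = chi 0 + 1 &
      exists d : R,
        h^-1 * (chi h - chi 0) @[h --> 0^'+] --> d /\
        h^-1 * (chi (1 + h) - chi 1) @[h --> 0^'-] --> d].

(* A monotone increasing solution, extended to the whole line. *)
Definition profile (R : realType) (n : nat) (g : R -> R) (p : 'rV[R]_n)
    (c : R) (chi : R -> R) : Prop :=
  [/\ solves_bvp g p c chi,
      {homo chi : x y / x <= y} &
      forall z, chi (z + 1) = chi z + 1].

(* Main.v *)
Require Import Defs.
From mathcomp Require Import all_boot all_order all_algebra.
From mathcomp Require Import all_classical all_reals all_analysis.
From mathcomp Require Import ring lra.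

Set Implicit Arguments.
Unset Strict Implicit.
Unset Printing Implicit Defensive.

Import Order.TTheory GRing.Theory Num.Theory.
Import numFieldNormedType.Exports.

Local Open Scope classical_set_scope.
Local Open Scope ring_scope.

(** Read along its own values, a profile is the flow of a first order equation.
Write [c * chi' = v (chi)] and put [m = |p|^2 / c^2]. The second order equation
then says that [m v^2 / 2] has derivative [v - g], the condition
[chi (z + 1) = chi z + 1] says that [v] has period 1, and [1 / c] is the time
spent by the flow [y' = v y] in one period, that is [int_0^1 1 / v]. So one
looks, for every [m >= 0], for a positive periodic [v_m] (a wave of mass [m];
[v_0 = g]), sets [c(m) = 1 / int_0^1 1 / v_m], and takes for [cbar r] the value
[c(m)] at the mass determined by [m * c(m)^2 = r^2]. The case [p = 0] is [m = 0].

Waves exist ([wave_exists_pos]) because [q = v^2 / 2] solves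
[m q' = sqrt (2 q) - g], whose right-hand side increases with [q]: rewritten
as a linear equation with a frozen nonlinear part, it is the fixed point problem
of a contraction on periodic functions.

Two waves are compared through [D = (m2 v2^2 - m1 v1^2) / 2], for which
[D' = v2 - v1]. The waves agree where [D] is extremal, which squeezes [D] between
multiples of [m2 - m1] ([wave_gap]); this makes [c] continuous. Moreover
[1 / v1 - 1 / v2 = D' / (v1 v2)] is at least [(m2 - m1) / 2] times the derivative
of [ln D], whose integral over a period vanishes, so [c] is nondecreasing in [m]
([speed_le]). Hence [m * c(m)^2] is an increasing bijection of the half-line;
[cbar r] is nondecreasing and [cbar r / r = m ^ (- 1 / 2)] is nonincreasing, and
together these give the continuity of [cbar] at every [r > 0].

For small [m] the wave is within [O(m)] of [g] ([wave_near0]), for large [m] its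
oscillation is [O(1 / m)] while its mean is the mean of [g] ([wave_far]); these
are the two limits of [cbar]. The strict bound is the strict inequality between
harmonic and arithmetic means, applied to [v_m] ([harmonic_lt_mean]).

Conversely every profile comes from a wave ([profile_flow]). Integrating its
equation once gives an identity without second derivatives, which passes to
the endpoints and then to the line ([profile_first_integral]). The difference of
[m (c chi')^2 / 2] and [m v_m(chi)^2 / 2] is periodic with derivative
[chi' (c chi' - v_m(chi))]; as [chi' > 0], it vanishes at its extrema, hence
identically. A profile is therefore the inverse of [c int 1 / v_m] up to a
translation, and the integral identities and the uniform limits are read off
from the flow. *)

(** * Derivatives and primitives on the line *)

Section calculus.
Context {R : realType}.
Implicit Types (f F h : R -> R) (x y : R).

(** A plain proposition rather than the class [is_derive]: instance resolution
would otherwise try to solve the premises of the rules below before the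
derivative has been determined by unification. *)
Definition has_deriv f x (d : R) : Prop := is_derive x (1 : R) f d.

Lemma hd_eq f x a b : has_deriv f x a -> a = b -> has_deriv f x b.
Proof. by move=> ? <-. Qed.

Lemma hd_cst (k : R) x : has_deriv (fun=> k) x 0.
Proof. exact: (@is_derive_cst R R R). Qed.

Lemma hd_id x : has_deriv (fun y => y) x 1.
Proof. exact: (@is_derive_id R R). Qed.

Lemma hdD f h x a b : has_deriv f x a -> has_deriv h x b ->
  has_deriv (fun y => f y + h y) x (a + b).
Proof. exact: is_deriveD. Qed.

Lemma hdB f h x a b : has_deriv f x a -> has_deriv h x b ->
  has_deriv (fun y => f y - h y) x (a - b).
Proof. exact: is_deriveB. Qed.

Lemma hdN f x a : has_deriv f x a -> has_deriv (fun y => - f y) x (- a).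
Proof. exact: is_deriveN. Qed.

Lemma hdZ k f x a : has_deriv f x a -> has_deriv (fun y => k * f y) x (k * a).
Proof. exact: is_deriveZ. Qed.

Lemma hdM f h x a b : has_deriv f x a -> has_deriv h x b ->
  has_deriv (fun y => f y * h y) x (a * h x + f x * b).
Proof.
move=> df dh; have D : has_deriv (f * h) x _ := is_deriveM df dh.
by apply: (hd_eq D); rewrite /GRing.scale /=; ring.
Qed.

Lemma hd_sqr f x a : has_deriv f x a ->
  has_deriv (fun y => f y ^+ 2) x (2 * f x * a).
Proof.
move=> df; under eq_fun do rewrite expr2.
by apply: hd_eq; [exact: (hdM df df) | ring].
Qed.

Lemma hd_comp f h x a b : has_deriv f (h x) a -> has_deriv h x b ->
  has_deriv (fun y => f (h y)) x (a * b).
Proof. exact: is_derive1_comp. Qed.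

Lemma hd_shift f x k a : has_deriv f (x + k) a -> has_deriv (fun y => f (y + k)) x a.
Proof.
move=> df; apply: hd_eq; last exact: mulr1.
apply: hd_comp; first exact: df.
by apply: hd_eq; [apply: hdD; [exact: hd_id|exact: hd_cst]|rewrite addr0].
Qed.

Lemma hd_continuous_at f x a : has_deriv f x a -> {for x, continuous f}.
Proof. by move=> [df _]; exact/differentiable_continuous/derivable1_diffP. Qed.

Lemma hd_continuous F f : (forall x, has_deriv F x (f x)) -> continuous F.
Proof. by move=> dF x; apply: hd_continuous_at (dF x). Qed.

Lemma hd_uniq f x a b : has_deriv f x a -> has_deriv f x b -> a = b.
Proof. by move=> [_ <-] [_ <-]. Qed.

Lemma hd_derive1 f x a : has_deriv f x a -> derive1 f x = a.
Proof. by move=> [_ <-]; rewrite derive1E. Qed.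

Lemma mean_value F f a b : a <= b -> (forall x, has_deriv F x (f x)) ->
  exists2 c, a <= c <= b & F b - F a = f c * (b - a).
Proof.
move=> ab dF; have [||c] := @MVT_segment R F f a b ab.
- by move=> x _; exact: dF.
- by apply/continuous_subspaceT; exact: hd_continuous dF.
by rewrite in_itv /= => cab E; exists c.
Qed.

Lemma deriv_ge0_homo F f : (forall x, has_deriv F x (f x)) ->
  (forall x, 0 <= f x) -> {homo F : x y / x <= y}.
Proof.
move=> dF f0 x y xy; have [c _ E] := mean_value xy dF.
by rewrite -subr_ge0 E mulr_ge0 // subr_ge0.
Qed.

Lemma deriv_gt0_homo F f : (forall x, has_deriv F x (f x)) ->
  (forall x, 0 < f x) -> {homo F : x y / x < y}.
Proof.
move=> dF f0 x y xy; have [c _ E] := mean_value (ltW xy) dF.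
by rewrite -subr_gt0 E mulr_gt0 // subr_gt0.
Qed.

Lemma deriv_le_bound F f k a b : (forall x, has_deriv F x (f x)) ->
  (forall x, `|f x| <= k) -> `|F b - F a| <= k * `|b - a|.
Proof.
move=> dF fk; wlog ab : a b / a <= b => [H|].
  by case: (leP a b) => [/H//|/ltW/H]; rewrite distrC (distrC a b).
have [c _ ->] := mean_value ab dF.
by rewrite normrM ler_wpM2r.
Qed.

Lemma deriv0_cst F x y : (forall x, has_deriv F x 0) -> F x = F y.
Proof. exact: is_derive_0_is_cst. Qed.

(** If [d > 0], the difference quotients at [x] are positive near [x]. *)
Lemma hd_right_max f x d e : has_deriv f x d -> 0 < e ->
  (forall y, x <= y <= x + e -> f y <= f x) -> d <= 0.
Proof.
move=> /is_derive1_caratheodory[w [fE cw <-]] e0 mx; rewrite leNgt; apply/negP => w0.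
have /nbhs_ballP[e' /= e'0 he] : \forall y \near x, 0 < w y by exact: (cvgr_gt _ cw _ w0).
pose h := Num.min e (e' / 2).
have h0 : 0 < h by rewrite lt_min e0 divr_gt0.
have yx : x <= x + h <= x + e by rewrite lerDl ltW //= lerD2l ge_min lexx.
have := mx _ yx; rewrite -subr_le0 fE addrAC subrr add0r leNgt mulr_gt0 //.
apply: he; rewrite /ball /= opprD addrA subrr add0r normrN gtr0_norm //.
by rewrite gt_min; apply/orP; right; rewrite ltr_pdivrMr // mulr_natr mulr2n ltrDl.
Qed.

Lemma hd_left_max f x d e : has_deriv f x d -> 0 < e ->
  (forall y, x - e <= y <= x -> f y <= f x) -> 0 <= d.
Proof.
move=> df e0 mx; rewrite -oppr_le0.
have dg : has_deriv (fun y => f (- y)) (- x) (- d).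
  apply: hd_eq; last exact: mulrN1.
  by apply: hd_comp; [rewrite opprK; exact: df|exact: hdN (hd_id _)].
apply: (hd_right_max dg e0) => y /andP[h1 h2]; rewrite opprK; apply: mx; lra.
Qed.

Lemma deriv0_open F a b x y : (forall z, z \in `]a, b[ -> has_deriv F z 0) ->
  x \in `]a, b[ -> y \in `]a, b[ -> F x = F y.
Proof.
move=> dF; wlog xy : x y / x <= y => [H|].
  by move=> hx hy; case: (leP x y) => [/H->|/ltW/H->].
rewrite !in_itv /= => /andP[ax xb] /andP[ay yb].
have sub z : z \in `[x, y] -> z \in `]a, b[.
  by rewrite !in_itv /= => /andP[h1 h2]; rewrite (lt_le_trans ax) // (le_lt_trans h2).
have [||c _ /eqP] := @MVT_segment R F (fun=> 0) x y xy.
- by move=> z hz; apply: dF; apply: sub; apply: subset_itv_oo_cc hz.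
- by apply: derivable_within_continuous => z /sub/dF[].
by rewrite mul0r subr_eq0 => /eqP.
Qed.

(** Derivatives have no isolated jump: a derivative that vanishes inside an
interval vanishes at its endpoints. This carries an equation known on the open
interval to the endpoints without any continuity of the derivative. *)
Lemma deriv0_closure F f a b : a < b -> (forall x, has_deriv F x (f x)) ->
  (forall x, x \in `]a, b[ -> f x = 0) -> forall x, x \in `[a, b] -> f x = 0.
Proof.
move=> ab dF f0.
have Fa x : x \in `[a, b] -> F x = F a.
  rewrite in_itv /= le_eqVlt => /andP[/predU1P[<-//|ax] xb].
  have [|c ca /eqP] := @MVT R F f a x ax (fun z _ => dF z).
    exact/continuous_subspaceT/(hd_continuous dF).
  rewrite f0 ?mul0r ?subr_eq0; first by move=> /eqP.
  by move: ca; rewrite !in_itv /= => /andP[-> /lt_le_trans->].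
move=> x xab; have Fx := Fa _ xab.
move: (xab); rewrite in_itv /= => /andP[ax]; rewrite le_eqVlt => /predU1P[xb|xb].
  subst b; have h y : x - (x - a) <= y <= x -> F y = F x.
    by rewrite opprB addrC subrK => hy; rewrite Fx Fa // in_itv.
  have ba : 0 < x - a by rewrite subr_gt0.
  apply/le_anti/andP; split; last by apply: (hd_left_max (dF x) ba) => y /h ->.
  rewrite -oppr_ge0.
  by apply: (hd_left_max (hdN (dF x)) ba) => y /h ->.
have h y : x <= y <= x + (b - x) -> F y = F x.
  rewrite addrC subrK => /andP[h1 h2]; rewrite Fx Fa // in_itv /= h2.
  by rewrite (le_trans ax).
have ba : 0 < b - x by rewrite subr_gt0.
apply/le_anti/andP; split.
  by apply: (hd_right_max (dF x) ba) => y /h ->.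
rewrite -oppr_le0.
by apply: (hd_right_max (hdN (dF x)) ba) => y /h ->.
Qed.

Local Notation mu := (@lebesgue_measure R).

Lemma continuous_integrable f a b : continuous f ->
  mu.-integrable `[a, b] (EFin \o f).
Proof.
move=> cf; apply: continuous_compact_integrable; first exact: segment_compact.
exact/continuous_subspaceT.
Qed.

Lemma Rint_chasles f a b x : continuous f -> a <= b -> b <= x ->
  \int[mu]_(t in `[a, x]) f t =
  \int[mu]_(t in `[a, b]) f t + \int[mu]_(t in `[b, x]) f t.
Proof.
move=> cf ab bx.
have := @Rintegral_itvB R f (BLeft a) (BRight x) b.
rewrite !bnd_simp => /(_ (continuous_integrable _ _ cf) ab bx).
rewrite Rintegral_itv_obnd_cbnd => [<-|]; first by rewrite addrC subrK.
apply: integrableS (continuous_integrable b x cf) => //.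
by apply: subset_itvr; rewrite bnd_simp.
Qed.

(** The integral from a fixed base point is a primitive only to the right of that
point, so the base point moves with [x]; the values do not depend on it since
each primitive is normalized to vanish at 0. *)
Lemma continuous_primitive f : continuous f ->
  exists F, forall x, has_deriv F x (f x).
Proof.
move=> cf; pose P a x := \int[mu]_(t in `[a, x]) f t.
pose lo x := - (`|x| + 1).
exists (fun x => P (lo x) x - P (lo x) 0) => x0.
have lox : lo x0 - 1 < x0 by rewrite /lo; have := ler_norm (- x0); rewrite normrN; lra.
have dP : has_deriv (fun x => P (lo x0 - 1) x - P (lo x0 - 1) 0) x0 (f x0).
  have [|||| dd ff] := @continuous_FTC1_closed R f (lo x0 - 1) x0 (x0 + 1).
  - by rewrite ltrDl.
  - exact: continuous_integrable.
  - exact: lox.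
  - exact: cf.
  rewrite -[f x0]subr0; apply: hdB; last exact: hd_cst.
  by apply: DeriveDef => //; rewrite -derive1E.
apply: near_eq_is_derive dP.
near=> x.
have lx : lo x0 - 1 <= lo x.
  rewrite /lo; have : `|x - x0| < 1.
    by rewrite distrC; near: x; apply: cvgr_dist_lt.
  have := ler_normD (x - x0) x0; rewrite subrK.
  by lra.
have lx0 : lo x <= 0 by rewrite /lo; have := normr_ge0 x; lra.
have lxx : lo x <= x by rewrite /lo; have := ler_norm (- x); rewrite normrN; lra.
by rewrite /P (Rint_chasles cf lx lxx) (Rint_chasles cf lx lx0); ring.
Unshelve. all: by end_near. Qed.

Lemma Rint01E F f : continuous f -> (forall x, has_deriv F x (f x)) ->
  \int[mu]_(x in `[0, 1]) f x = F 1 - F 0.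
Proof.
move=> cf dF; rewrite /Rintegral (@continuous_FTC2 R f F 0 1) //.
- exact/continuous_subspaceT.
- have cF := hd_continuous dF; split.
  + by move=> x _; have [] := dF x.
  + exact/cvg_at_right_filter/cF.
  + exact/cvg_at_left_filter/cF.
- by move=> x _; exact: hd_derive1 (dF x).
Qed.

End calculus.

(** * Periodic functions *)

Section periodic.
Context {R : realType}.
Implicit Types (f F h q : R -> R) (x y : R).

Lemma periodic_int f x (k : int) : periodic f 1 -> f (x + k%:~R) = f x.
Proof.
move=> pf; have E n y : f (y + n%:R) = f y.
  elim: n => [|n IH]; first by rewrite addr0.
  by rewrite -natr1 addrA pf IH.
case: k => n; first exact: E.
by rewrite NegzE mulrNz -[in RHS](subrK (n.+1%:~R) x) E.
Qed.

Lemma unit_repr x : exists k : int, 0 <= x - k%:~R < 1.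
Proof.
exists (Num.floor x); rewrite subr_ge0 floor_le_tmp ltrBlDl.
by have := floorD1_gt x; rewrite intrD.
Qed.

Lemma periodic_argmax f : periodic f 1 -> continuous f ->
  exists x0, forall x, f x <= f x0.
Proof.
move=> pf cf; have [||x0 _ mx] := @EVT_max R f 0 1; first exact: ler01.
  exact/continuous_subspaceT.
exists x0 => x; have [k /andP[k0 k1]] := unit_repr x.
rewrite -(subrK (k%:~R) x) periodic_int //.
by apply: mx; rewrite in_itv /= k0 ltW.
Qed.

Lemma periodic_argmin f : periodic f 1 -> continuous f ->
  exists x0, forall x, f x0 <= f x.
Proof.
move=> pf cf; have [||x0 mx] := @periodic_argmax (fun x => - f x).
- by move=> x; rewrite pf.
- by move=> x; apply: cvgN; exact: cf.
by exists x0 => x; rewrite -lerN2.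
Qed.

(** The maximum principle used throughout: bounding a periodic function amounts
to bounding it at the zeros of its derivative. *)
Lemma periodic_crit_max f f' : periodic f 1 -> (forall x, has_deriv f x (f' x)) ->
  exists2 x0, f' x0 = 0 & forall x, f x <= f x0.
Proof.
move=> pf df; have [x0 mx] := periodic_argmax pf (hd_continuous df).
exists x0 => //.
apply: hd_uniq (df x0) _.
apply: (@derive1_at_max _ f (x0 - 1) (x0 + 1)) => //.
- by lra.
- by move=> t _; have [] := df t.
- by rewrite in_itv /=; lra.
Qed.

Lemma periodic_crit_min f f' : periodic f 1 -> (forall x, has_deriv f x (f' x)) ->
  exists2 x0, f' x0 = 0 & forall x, f x0 <= f x.
Proof.
move=> pf df; have [||x0 e0 mn] := @periodic_crit_max (fun x => - f x) (fun x => - f' x).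
- by move=> x; rewrite pf.
- by move=> x; exact: hdN.
exists x0; first by apply/eqP; rewrite -oppr_eq0; apply/eqP.
by move=> x; rewrite -lerN2.
Qed.

Lemma periodic_primitive F f x y : (forall x, has_deriv F x (f x)) -> periodic f 1 ->
  F (x + 1) - F x = F (y + 1) - F y.
Proof.
move=> dF pf; apply: (deriv0_cst (F := fun z => F (z + 1) - F z)) => z.
apply: hd_eq; first by apply: hdB; [exact: hd_shift (dF (z + 1))|exact: dF].
by rewrite pf subrr.
Qed.

(** At a maximum of [q1 - q2] the two equations force [q1 - q2 = h1 - h2], so the
solution operator of [q' = lam (q - h)] is monotone and non-expansive for the sup
distance. *)
Lemma lin_periodic_le lam q1 q2 h1 h2 e : 0 < lam ->
  periodic q1 1 -> periodic q2 1 ->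
  (forall x, has_deriv q1 x (lam * (q1 x - h1 x))) ->
  (forall x, has_deriv q2 x (lam * (q2 x - h2 x))) ->
  (forall x, h1 x - h2 x <= e) -> forall x, q1 x - q2 x <= e.
Proof.
move=> l0 p1 p2 d1 d2 he.
have [||x0 e0 mx] := @periodic_crit_max (fun x => q1 x - q2 x)
    (fun x => lam * (q1 x - h1 x) - lam * (q2 x - h2 x)).
- by move=> x; rewrite p1 p2.
- by move=> x; exact: hdB.
move=> x; apply: (le_trans (mx x)).
suff -> : q1 x0 - q2 x0 = h1 x0 - h2 x0 by [].
apply/eqP; rewrite -subr_eq0; apply/eqP/(mulfI (lt0r_neq0 l0)).
by rewrite mulr0 -e0; ring.
Qed.

Lemma lin_periodic_dist lam q1 q2 h1 h2 e : 0 < lam ->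
  periodic q1 1 -> periodic q2 1 ->
  (forall x, has_deriv q1 x (lam * (q1 x - h1 x))) ->
  (forall x, has_deriv q2 x (lam * (q2 x - h2 x))) ->
  (forall x, `|h1 x - h2 x| <= e) -> forall x, `|q1 x - q2 x| <= e.
Proof.
move=> l0 p1 p2 d1 d2 he x.
rewrite ler_norml -lerN2 opprK opprB.
rewrite (lin_periodic_le l0 p2 p1 d2 d1); last first.
  by move=> y; have := he y; rewrite distrC; apply/le_trans/ler_norm.
rewrite (lin_periodic_le l0 p1 p2 d1 d2) // => y.
exact: le_trans (ler_norm _) (he y).
Qed.

Lemma hd_expR k x : has_deriv (fun y => expR (k * y)) x (k * expR (k * x)).
Proof.
apply: hd_eq; first apply: hd_comp.
- exact: is_derive_expR.
- exact: (hdZ k (hd_id x)).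
by rewrite mulr1 mulrC.
Qed.

(** Variation of constants. With [Phi' = lam e^(- lam x) h], the increment
[Phi (x + 1) - Phi x] is multiplied by [e^(- lam)] when [x] advances by a
period, so [e^(lam x)] times the increment is periodic. *)
Lemma lin_periodic_exists lam h : 0 < lam -> continuous h -> periodic h 1 ->
  exists2 q, periodic q 1 & forall x, has_deriv q x (lam * (q x - h x)).
Proof.
move=> l0 ch ph.
have [|Phi dPhi] := @continuous_primitive R (fun y => lam * (expR (- lam * y) * h y)).
  move=> x; apply: cvgM; first exact: cvg_cst.
  apply: cvgM; last exact: ch.
  exact: (hd_continuous_at (hd_expR (- lam) x)).
set e := expR (- lam).
have e1 : 1 - e != 0.
  by rewrite subr_eq0 gt_eqF // /e expR_lt1 oppr_lt0.
have expS x : expR (- lam * (x + 1)) = expR (- lam * x) * e.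
  by rewrite mulrDr mulr1 expRD.
(* Both sides are values of a function with zero derivative, one period apart. *)
have PhiS x : Phi (x + 1 + 1) - e * Phi (x + 1) = Phi (x + 1) - e * Phi x.
  apply: (deriv0_cst (F := fun y => Phi (y + 1) - e * Phi y)) => y.
  apply: hd_eq; first by apply: hdB; [exact: hd_shift (dPhi (y + 1))|exact: hdZ (dPhi y)].
  by rewrite ph expS; ring.
have expK x : expR (lam * x) * expR (- lam * x) = 1.
  by rewrite -expRD mulNr subrr expR0.
exists (fun x => (1 - e)^-1 * (expR (lam * x) * (Phi (x + 1) - Phi x))).
  move=> x.
  have -> : Phi (x + 1 + 1) - Phi (x + 1) = e * (Phi (x + 1) - Phi x).
    by have := PhiS x; lra.
  by rewrite mulrDr mulr1 expRD -mulrA (mulrA (expR lam)) -expRD subrr expR0 mul1r.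
move=> x; apply: hd_eq.
  apply: hdZ; apply: hdM; first exact: hd_expR.
  by apply: hdB; [exact: hd_shift (dPhi (x + 1))|exact: dPhi].
rewrite ph expS; have := expK x.
set u := expR (lam * x); set w := expR _ => uw.
have -> : lam * u * (Phi (x + 1) - Phi x) + u * (lam * (w * e * h x) - lam * (w * h x)) =
  lam * (u * (Phi (x + 1) - Phi x)) - (u * w) * (lam * h x * (1 - e)) by ring.
by rewrite uw; field.
Qed.

End periodic.

(** * Integrals over one period *)

Section mean_over_period.
Context {R : realType}.
Implicit Types (f F h : R -> R) (x y : R).
Local Notation mu := (@lebesgue_measure R).

Definition int01 f := \int[mu]_(x in `[0, 1]) f x.

Lemma int01_primitive f : continuous f ->
  exists2 F, forall x, has_deriv F x (f x) & int01 f = F 1 - F 0.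
Proof.
move=> cf; have [F dF] := continuous_primitive cf.
by exists F => //; exact: Rint01E.
Qed.

Lemma int01D f h : continuous f -> continuous h ->
  int01 (fun x => f x + h x) = int01 f + int01 h.
Proof.
move=> cf ch; have [F dF ->] := int01_primitive cf.
have [H dH ->] := int01_primitive ch.
rewrite /int01 (@Rint01E R (fun x => F x + H x)).
- by ring.
- by move=> x; apply: cvgD; [exact: cf|exact: ch].
- by move=> x; exact: hdD.
Qed.

Lemma int01Z k f : continuous f -> int01 (fun x => k * f x) = k * int01 f.
Proof.
move=> cf; have [F dF ->] := int01_primitive cf.
rewrite /int01 (@Rint01E R (fun x => k * F x)).
- by ring.
- by move=> x; apply: cvgM; [exact: cvg_cst|exact: cf].
- by move=> x; exact: hdZ.
Qed.

Lemma int01_cst k : int01 (fun=> k) = k.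
Proof.
rewrite /int01 (@Rint01E R (fun x => k * x)).
- by ring.
- by move=> x; exact: cvg_cst.
- by move=> x; apply: hd_eq; [exact: (hdZ k (hd_id x))|rewrite mulr1].
Qed.

Lemma int01_le f h : continuous f -> continuous h -> (forall x, f x <= h x) ->
  int01 f <= int01 h.
Proof.
move=> cf ch fh; have [F dF ->] := int01_primitive cf.
have [H dH ->] := int01_primitive ch.
have mHF : {homo (fun x => H x - F x) : x y / x <= y}.
  by apply: (@deriv_ge0_homo R _ (fun x => h x - f x)) => x;
    [exact: hdB|rewrite subr_ge0].
by have := mHF _ _ (@ler01 R); lra.
Qed.

(** A nondecreasing primitive that does not grow over one period, hence over any
number of periods, is constant. *)
Lemma int01_periodic_eq0 f : continuous f -> periodic f 1 -> (forall x, 0 <= f x) ->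
  int01 f = 0 -> forall x, f x = 0.
Proof.
move=> cf pf f0; have [F dF ->] := int01_primitive cf => F10.
have mF := deriv_ge0_homo dF f0.
have FS x : F (x + 1) - F x = F (0 + 1) - F 0 := periodic_primitive x 0 dF pf.
have Fn n : F n%:R = F 0.
  elim: n => [//|n <-]; have := FS n%:R.
  by rewrite natr1 add0r F10 => /eqP; rewrite subr_eq0 => /eqP.
have FNn n : F (- n%:R) = F 0.
  elim: n => [|n <-]; first by rewrite oppr0.
  have := FS (- n.+1%:R); rewrite -natr1 opprD addrNK add0r F10.
  by move=> /eqP; rewrite subr_eq0 => /eqP.
have cF x : F x = F 0.
  have [n xn] : exists n : nat, `|x| < n%:R.
    by exists (Num.bound `|x|); apply: archi_boundP.
  move: xn; rewrite ltr_norml => /andP[x1 x2].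
  by apply/eqP; rewrite eq_le -{1}(Fn n) -(FNn n) !mF ?ltW.
move=> x; apply: hd_uniq (dF x) _.
by rewrite (_ : F = fun=> F 0); [exact: hd_cst|exact/funext].
Qed.

End mean_over_period.

(** * Waves: the profile equation on the circle *)

Section geometric.
Context {R : realType}.

(** The sequences [u n - K t^n] and [u n + K t^n], with [K = C / (1 - t)], form
nested intervals; the limit is the supremum of the lower ends. *)
Lemma geometric_cvg (u : nat -> R) C t : 0 <= t < 1 ->
  (forall n, `|u n.+1 - u n| <= C * t ^+ n) ->
  exists l, forall n, `|l - u n| <= C / (1 - t) * t ^+ n.
Proof.
move=> /andP[t0 t1] hu; have t1' : 0 < 1 - t by rewrite subr_gt0.
set K := C / (1 - t); have KC : C = K * (1 - t) by rewrite /K; field; rewrite gt_eqF.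
pose a n := u n - K * t ^+ n; pose b n := u n + K * t ^+ n.
have st n : a n <= a n.+1 /\ b n.+1 <= b n.
  have := hu n; rewrite ler_norml KC /a /b exprS; set w := t ^+ n => /andP[].
  have -> : K * (1 - t) * w = K * w - K * (t * w) by ring.
  by split; lra.
have C0 : 0 <= C by have := hu 0; rewrite expr0 mulr1; apply: le_trans.
have K0 : 0 <= K by rewrite /K divr_ge0 // ltW.
have ab n : a n <= b n.
  have : 0 <= K * t ^+ n by rewrite mulr_ge0 // exprn_ge0.
  by rewrite /a /b; lra.
have ma : {homo a : n m / (n <= m)%N >-> n <= m}.
  by apply: homo_leq => [x|x y z|n]; [exact: lexx|exact: le_trans|have [] := st n].
have mb n m : (n <= m)%N -> b m <= b n.
  move=> nm; rewrite -lerN2; apply: (@homo_leq _ (fun n => - b n) (fun x y => x <= y)) nm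
    => [x|x y z|k].
  - exact: lexx.
  - exact: le_trans.
  - by rewrite lerN2; have [] := st k.
have anb n m : a n <= b m.
  have [nm|mn] := leqP n m.
    exact: le_trans (ma _ _ nm) (ab m).
  exact: le_trans (ab n) (mb _ _ (ltnW mn)).
exists (sup (range a)) => n.
have u1 : a n <= sup (range a).
  apply: ub_le_sup; last by exists n.
  by exists (b 0) => _ [k _ <-].
have u2 : sup (range a) <= b n.
  apply: ge_sup; first by exists (a 0), 0.
  by move=> _ [k _ <-].
by move: u1 u2; rewrite /a /b ler_norml; lra.
Qed.

End geometric.

Section waves.
Context {R : realType}.
Implicit Types (g v q : R -> R) (m x y : R).

(** [wave g m v]: the flow [y' = v y] solves [m y'' - y' + g y = 0]. In terms of
the square of [v] the equation still makes sense for [m = 0], where it reads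
[v = g]. *)
Definition wave g m v := [/\ periodic v 1, continuous v, forall x, 0 < v x &
  forall x, has_deriv (fun y => m / 2 * v y ^+ 2) x (v x - g x)].

Lemma wave0 g v : wave g 0 v -> v = g.
Proof.
move=> [_ _ _ dv]; apply/funext => x; apply/eqP; rewrite -subr_eq0; apply/eqP.
apply: hd_uniq (dv x) _.
rewrite (_ : (fun _ => _) = fun=> 0); first exact: hd_cst.
by apply/funext => y; rewrite !mul0r.
Qed.

Lemma wave_at0 g : periodic g 1 -> continuous g -> (forall x, 0 < g x) -> wave g 0 g.
Proof.
move=> pg cg g0; split => // x; rewrite subrr.
rewrite (_ : (fun _ => _) = fun=> 0); first exact: hd_cst.
by apply/funext => y; rewrite !mul0r.
Qed.

Lemma half_sqr_le m a b : 0 < m -> 0 < a -> 0 < b ->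
  m / 2 * a ^+ 2 <= m / 2 * b ^+ 2 -> a <= b.
Proof.
move=> m0 a0 b0; rewrite ler_pM2l ?divr_gt0 //.
by rewrite ler_sqr // nnegrE ltW.
Qed.

Lemma wave_bounds g m v A B : 0 <= m -> (forall x, A <= g x <= B) ->
  wave g m v -> forall x, A <= v x <= B.
Proof.
rewrite le_eqVlt => /predU1P[<-|m0] gAB wv; first by rewrite (wave0 wv).
have [pv cv v0 dv] := wv.
have pD : periodic (fun y => m / 2 * v y ^+ 2) 1 by move=> x; rewrite pv.
move=> x; apply/andP; split.
  have [x0 /eqP + mn] := periodic_crit_min pD dv.
  rewrite subr_eq0 => /eqP e0.
  apply: (@le_trans _ _ (v x0)); last exact: half_sqr_le (mn x).
  by rewrite e0; case/andP: (gAB x0).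
have [x0 /eqP + mx] := periodic_crit_max pD dv.
rewrite subr_eq0 => /eqP e0.
apply: (@le_trans _ _ (v x0)); first exact: half_sqr_le (mx x).
by rewrite e0; case/andP: (gAB x0).
Qed.

(** The bracketed difference has derivative [v2 - v1], so at its extrema the two
waves take a common value, which lies between [A] and [B]. *)
Lemma wave_gap g m1 m2 v1 v2 A B : 0 <= m1 <= m2 -> 0 < A ->
  (forall x, A <= g x <= B) -> wave g m1 v1 -> wave g m2 v2 ->
  forall x, (m2 - m1) / 2 * A ^+ 2 <=
    m2 / 2 * v2 x ^+ 2 - m1 / 2 * v1 x ^+ 2 <= (m2 - m1) / 2 * B ^+ 2.
Proof.
move=> /andP[m1_0 m12] A0 gAB w1 w2.
have b1 := wave_bounds m1_0 gAB w1.
have [p1 c1 v1_0 d1] := w1; have [p2 c2 v2_0 d2] := w2.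
pose D y := m2 / 2 * v2 y ^+ 2 - m1 / 2 * v1 y ^+ 2.
have pD : periodic D 1 by move=> x; rewrite /D p1 p2.
have dD x : has_deriv D x (v2 x - v1 x).
  by apply: hd_eq; [exact: hdB|ring].
have crit x : v2 x - v1 x = 0 ->
    (m2 - m1) / 2 * A ^+ 2 <= D x <= (m2 - m1) / 2 * B ^+ 2.
  move/eqP; rewrite subr_eq0 /D => /eqP ->.
  have -> : m2 / 2 * v1 x ^+ 2 - m1 / 2 * v1 x ^+ 2 = (m2 - m1) / 2 * v1 x ^+ 2.
    by ring.
  have /andP[Av vB] := b1 x.
  have h0 : 0 <= (m2 - m1) / 2 by rewrite divr_ge0 // subr_ge0.
  by rewrite !ler_wpM2l // ler_sqr // nnegrE; apply/ltW => //; apply: lt_le_trans vB.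
move=> x; apply/andP; split.
  have [x0 e0 mn] := periodic_crit_min pD dD.
  by apply: le_trans (mn x); case/andP: (crit _ e0).
have [x0 e0 mx] := periodic_crit_max pD dD.
by apply: (le_trans (mx x)); case/andP: (crit _ e0).
Qed.

Lemma wave_deriv g m v x : 0 < m -> wave g m v ->
  has_deriv v x ((v x - g x) / (m * v x)).
Proof.
move=> m0 [_ _ v0 dv].
have -> : v = fun y => Num.sqrt (2 / m * (m / 2 * v y ^+ 2)).
  apply/funext => y; rewrite mulrA (_ : 2 / m * (m / 2) = 1); last first.
    by field; rewrite gt_eqF.
  by rewrite mul1r sqrtr_sqr gtr0_norm.
have E y : 2 / m * (m / 2 * v y ^+ 2) = v y ^+ 2 by field; rewrite gt_eqF.
apply: hd_eq.
  apply: (hd_comp _ (hdZ (2 / m) (dv x))).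
  by apply: is_derive1_sqrt; rewrite E exprn_gt0.
by rewrite E sqrtr_sqr gtr0_norm //; field; rewrite !gt_eqF.
Qed.

Lemma continuous_sqrt_comp q : continuous q -> continuous (fun x => Num.sqrt (q x)).
Proof. by move=> cq x; apply: continuous_comp; [exact: cq|exact: sqrt_continuous]. Qed.

Section existence.
Context (g : R -> R) (A B m : R) (pg : periodic g 1) (cg : continuous g).
Context (gAB : forall x, A <= g x <= B) (A0 : 0 < A) (m0 : 0 < m).

(** With [lam = 1 / (m A)], the equation [m q' = sqrt (2 q) - g] for
[q = v^2 / 2] reads [q' = lam (q - S q)]. The coefficient [A] is the largest for
which [q - A sqrt (2 q)] is nondecreasing on [q >= A^2 / 2]. *)
Let S q x := q x - A * (Num.sqrt (2 * q x) - g x).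

Let admissible q := [/\ periodic q 1, continuous q &
  forall x, A ^+ 2 / 2 <= q x <= B ^+ 2 / 2].

Let AB : A <= B.
Proof. by have /andP[] := gAB 0; apply: le_trans. Qed.

Let B0 : 0 < B. Proof. exact: lt_le_trans AB. Qed.

Let root (a : R) : A ^+ 2 / 2 <= a <= B ^+ 2 / 2 ->
  A <= Num.sqrt (2 * a) <= B /\ a = Num.sqrt (2 * a) ^+ 2 / 2.
Proof.
move=> /andP[q1 q2].
have q0 : 0 <= 2 * a by have := sqr_ge0 A; lra.
have E := sqr_sqrtr q0; set w := Num.sqrt _ in E *.
have w0 : 0 <= w by exact: sqrtr_ge0.
split; last by rewrite E; field.
rewrite -(@ler_sqr _ A) ?nnegrE ?(ltW A0) // -(@ler_sqr _ w) ?nnegrE ?(ltW B0) //.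
by rewrite E; lra.
Qed.

Let S_admissible q : admissible q -> admissible (S q).
Proof.
move=> [pq cq qAB]; split.
- by move=> x; rewrite /S pq pg.
- move=> x; rewrite /S; apply: cvgB; first exact: cq.
  apply: cvgM; first exact: cvg_cst.
  apply: cvgB; last exact: cg.
  apply: (@continuous_sqrt_comp (fun z => 2 * q z)) => y; apply: cvgM; [exact: cvg_cst|exact: cq].
- move=> x; have [/andP[wA wB] Eq] := root (qAB x); rewrite /S.
  set w := Num.sqrt _ in wA wB Eq *; rewrite Eq.
  have /andP[gA gB] := gAB x; apply/andP; split.
    have h1 : 0 <= A * (g x - A) by rewrite mulr_ge0 ?subr_ge0 // ltW.
    by have := sqr_ge0 (w - A); lra.
  have h1 : 0 <= A * (B - g x) by rewrite mulr_ge0 ?subr_ge0 // ltW.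
  have h2 : 0 <= (B - w) * (B + w - 2 * A) by rewrite mulr_ge0 //; have := AB; lra.
  by lra.
Qed.

Let theta := 1 - A / B.

Let theta01 : 0 <= theta < 1.
Proof.
rewrite /theta subr_ge0 ler_pdivrMr // mul1r AB /=.
by rewrite ltrBlDr ltrDl divr_gt0.
Qed.

(** Since [q1 - q2 = (w1 - w2) (w1 + w2) / 2] with [w = sqrt (2 q)], the map
multiplies the difference by [1 - 2 A / (w1 + w2)], and [w1 + w2] lies between
[2 A] and [2 B]. *)
Let S_contract q1 q2 e : admissible q1 -> admissible q2 ->
  (forall x, `|q1 x - q2 x| <= e) -> forall x, `|S q1 x - S q2 x| <= theta * e.
Proof.
move=> [_ _ b1] [_ _ b2] he x.
have [/andP[w1A w1B] E1] := root (b1 x); have [/andP[w2A w2B] E2] := root (b2 x).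
rewrite /S; set w1 := Num.sqrt (2 * q1 x) in w1A w1B E1 *.
set w2 := Num.sqrt (2 * q2 x) in w2A w2B E2 *.
have s0 : 0 < w1 + w2 by rewrite addr_gt0 // (lt_le_trans A0).
have -> : q1 x - A * (w1 - g x) - (q2 x - A * (w2 - g x)) =
    (1 - 2 * A / (w1 + w2)) * (q1 x - q2 x).
  by rewrite E1 E2; field; rewrite gt_eqF.
rewrite normrM; apply: ler_pM => //.
rewrite ger0_norm.
  rewrite /theta lerD2l lerN2 ler_pdivlMr // mulrAC ler_pdivrMr //.
  have : 0 <= A * (2 * B - (w1 + w2)) by rewrite mulr_ge0 ?(ltW A0) //; lra.
  lra.
by rewrite subr_ge0 ler_pdivrMr // mul1r; lra.
Qed.

Let lam := (m * A)^-1.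
Let lam0 : 0 < lam. Proof. by rewrite invr_gt0 mulr_gt0. Qed.

Let exists_lin : exists T : (R -> R) -> R -> R, forall h, admissible h ->
  admissible (T h) /\ forall x, has_deriv (T h) x (lam * (T h x - h x)).
Proof.
suff /choice[T hT] : forall h, exists q, admissible h ->
    admissible q /\ forall x, has_deriv q x (lam * (q x - h x)) by exists T.
move=> h; have [ah|nh] := pselect (admissible h); last by exists h.
have [ph ch hAB] := ah.
have [q pq dq] := lin_periodic_exists lam0 ch ph.
exists q => _; split => //; split => //; first exact: hd_continuous dq.
have dcst k x : has_deriv (fun=> k : R) x (lam * (k - k)).
  by rewrite subrr mulr0; exact: hd_cst.
move=> x; apply/andP; split.
- rewrite -subr_le0.
  apply: (@lin_periodic_le R lam (fun=> _) q (fun=> A ^+ 2 / 2) h) => // y.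
  by rewrite subr_le0; case/andP: (hAB y).
- rewrite -subr_le0.
  apply: (@lin_periodic_le R lam q (fun=> _) h (fun=> B ^+ 2 / 2)) => // y.
  by rewrite subr_le0; case/andP: (hAB y).
Qed.

(** The fixed point of [q |-> T (S q)], where [T] solves the linear equation. The
limit of the iterates is only a uniform limit, but it equals its own image under
the non-expansive [T (S _)], and that image is differentiable. *)
Lemma wave_exists_pos : exists v, wave g m v.
Proof.
have [T hT] := exists_lin.
pose N q := T (S q).
have aN q : admissible q -> admissible (N q) by move=> /S_admissible /hT[].
have N_contract q1 q2 e : admissible q1 -> admissible q2 ->
    (forall x, `|q1 x - q2 x| <= e) -> forall x, `|N q1 x - N q2 x| <= theta * e.
  move=> a1 a2 he.
  have [[p1 _ _] d1] := hT _ (S_admissible a1).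
  have [[p2 _ _] d2] := hT _ (S_admissible a2).
  exact: lin_periodic_dist lam0 p1 p2 d1 d2 (S_contract a1 a2 he).
pose u n := iter n N (fun=> A ^+ 2 / 2).
have AB2 : A ^+ 2 / 2 <= B ^+ 2 / 2.
  by rewrite ler_pM2r ?invr_gt0 // ler_sqr // nnegrE ltW.
have au n : admissible (u n).
  elim: n => [|n IH]; last exact: aN.
  split => // x; last by rewrite lexx.
  exact: cvg_cst.
pose C := B ^+ 2 / 2.
have uC n x : `|u n.+1 x - u n x| <= C * theta ^+ n.
  elim: n x => [|n IH] x; last first.
    by rewrite exprS mulrCA; exact: (N_contract _ _ _ (au n.+1) (au n)).
  have [_ _ b1] := au 1%N; have [_ _ b0] := au 0%N.
  have := b1 x; have := b0 x; rewrite expr0 mulr1 ler_norml /C.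
  by have := sqr_ge0 A; lra.
have /choice[q hq] : forall x, exists l, forall n,
    `|l - u n x| <= C / (1 - theta) * theta ^+ n.
  by move=> x; apply: geometric_cvg.
set K := C / (1 - theta) in hq.
have small e : 0 < e -> exists n, K * theta ^+ n < e.
  move=> e0; have : K * theta ^+ n @[n --> \oo] --> (0 : R).
    rewrite -(mulr0 K); apply: cvgM; first exact: cvg_cst.
    by apply: cvg_expr; have /andP[t0 t1] := theta01; rewrite ger0_norm.
  move=> /cvgrPdist_lt /(_ _ e0) [n _ /(_ n (leqnn n))] /=.
  by rewrite sub0r normrN => /(le_lt_trans (ler_norm _)) ?; exists n.
(* All error bounds below are multiples of [K * theta ^+ n]. *)
have eq_small (a b : R) : (forall n, `|a - b| <= 2 * (K * theta ^+ n)) -> a = b.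
  move=> hab; suff : `|a - b| <= 0 by rewrite normr_le0 subr_eq0 => /eqP.
  rewrite leNgt; apply/negP => h0.
  have [|n] := small (`|a - b| / 2); first by rewrite divr_gt0.
  by have := hab n; lra.
have aq : admissible q.
  split.
  - move=> x; apply: eq_small => n.
    have [pu _ _] := au n.
    rewrite (_ : q (x + 1) - q x = (q (x + 1) - u n (x + 1)) - (q x - u n x)).
      apply: (le_trans (ler_normB _ _)).
      by have := hq (x + 1) n; have := hq x n; lra.
    by rewrite pu; ring.
  - move=> x; apply/cvgrPdist_lt => e e0.
    have [|n hn] := small (e / 3); first by rewrite divr_gt0.
    have [_ cu _] := au n.
    have e3 : 0 < e / 3 by rewrite divr_gt0.
    near=> y.
    have : `|u n x - u n y| < e / 3.
      by near: y; have /cvgrPdist_lt := cu x; exact.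
    have -> : q x - q y = (q x - u n x) + (u n x - u n y) - (q y - u n y) by ring.
    move=> h3; apply: (le_lt_trans (ler_normB _ _)).
    have := ler_normD (q x - u n x) (u n x - u n y).
    by have := hq x n; have := hq y n; lra.
  - move=> x; apply/andP; split; rewrite leNgt; apply/negP => hx.
    + have [|n hn] := small (A ^+ 2 / 2 - q x); first by rewrite subr_gt0.
      have [_ _ /(_ x)] := au n; have := hq x n; rewrite ler_norml.
      by lra.
    + have [|n hn] := small (q x - B ^+ 2 / 2); first by rewrite subr_gt0.
      have [_ _ /(_ x)] := au n; have := hq x n; rewrite ler_norml.
      by lra.
have Nq : N q = q.
  apply/funext => x; apply: eq_small => n.
  rewrite (_ : N q x - q x = (N q x - N (u n) x) - (q x - u n.+1 x)); last first.
    by have -> : u n.+1 x = N (u n) x by []; ring.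
  apply: (le_trans (ler_normB _ _)).
  have := N_contract _ _ _ aq (au n) (fun x => hq x n) x.
  have /andP[t0 t1] := theta01.
  have Kn : 0 <= K * theta ^+ n by apply: le_trans (hq x n).
  have := hq x n.+1; rewrite exprS.
  by nra.
have [_ dq] := hT _ (S_admissible aq); rewrite -/(N q) Nq in dq.
have [pq cq qAB] := aq.
exists (fun x => Num.sqrt (2 * q x)); split.
- by move=> x; rewrite pq.
- apply: (@continuous_sqrt_comp (fun z => 2 * q z)) => y.
  by apply: cvgM; [exact: cvg_cst|exact: cq].
- by move=> x; have [/andP[+ _] _] := root (qAB x); apply: lt_le_trans.
- move=> x; rewrite (_ : (fun _ => _) = fun y => m * q y); last first.
    apply/funext => y; have [_ E] := root (qAB y).
    by rewrite [in RHS]E; field.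
  apply: hd_eq; first exact: (hdZ m (dq x)).
  by rewrite /S /lam; field; rewrite !gt_eqF.
Unshelve. all: by end_near. Qed.

End existence.
End waves.

(** * Means of positive periodic functions *)

Section means.
Context {R : realType}.
Implicit Types (f v : R -> R) (x y a b : R).

Lemma int01_between f a b : continuous f -> (forall x, a <= f x <= b) -> a <= int01 f <= b.
Proof.
move=> cf fab; have cc (k : R) : continuous (fun _ : R => k).
  by move=> x; exact: cvg_cst.
apply/andP; split; [rewrite -(int01_cst a)|rewrite -(int01_cst b)];
  by apply: int01_le => // x; case/andP: (fab x).
Qed.

Lemma continuous_sqr_at f x : {for x, continuous f} ->
  {for x, continuous (fun y => f y ^+ 2)}.
Proof.
move=> cf; apply: (@continuous_comp _ _ _ f (fun y => y ^+ 2)) => //.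
exact: exprn_continuous.
Qed.

Lemma continuous_inv v : continuous v -> (forall x, 0 < v x) -> continuous (fun x => (v x)^-1).
Proof. by move=> cv v0 x; apply: cvgV; [rewrite gt_eqF|exact: cv]. Qed.

Lemma int01_inv_gt0 v : continuous v -> (forall x, 0 < v x) -> periodic v 1 ->
  0 < int01 (fun x => (v x)^-1).
Proof.
move=> cv v0 pv; have ci := continuous_inv cv v0; rewrite lt0r; apply/andP; split.
  apply/eqP => I0; have := int01_periodic_eq0 ci _ _ I0 0 => /(_ _ _)/eqP.
  have i0 x : 0 <= (v x)^-1 by rewrite invr_ge0 ltW.
  have pi : periodic (fun x => (v x)^-1) 1 by move=> x; rewrite pv.
  by move=> /(_ pi i0); rewrite invr_eq0 gt_eqF.
rewrite -(int01_cst 0); apply: int01_le => // x; first exact: cvg_cst.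
by rewrite invr_ge0 ltW.
Qed.

(** With [a] the mean of [v], the identity
[a^2 / v + v = (v - a)^2 / v + 2 a] integrates to
[a^2 (int 1 / v) - a = int (v - a)^2 / v > 0]. *)
Lemma harmonic_lt_mean v : continuous v -> (forall x, 0 < v x) -> periodic v 1 ->
  ~ (exists a, forall x, v x = a) ->
  (int01 (fun x => (v x)^-1))^-1 < int01 v.
Proof.
move=> cv v0 pv nv; have ci := continuous_inv cv v0.
have J0 := int01_inv_gt0 cv v0 pv.
have [x0 mn] := periodic_argmin pv cv.
set a := int01 v; have a0 : 0 < a.
  rewrite (lt_le_trans (v0 x0)) // /a -(int01_cst (v x0)).
  by apply: int01_le => // x; exact: cvg_cst.
pose w x := (v x - a) ^+ 2 * (v x)^-1.
have cw : continuous w.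
  move=> x; apply: cvgM; last exact: ci.
  apply: (@continuous_sqr_at (fun y => v y - a)).
  by apply: cvgB; [exact: cv|exact: cvg_cst].
have Ew : (fun x => a ^+ 2 * (v x)^-1 + v x) = (fun x => w x + 2 * a).
  by apply/funext => x; rewrite /w; field; rewrite gt_eqF.
have : int01 (fun x => a ^+ 2 * (v x)^-1 + v x) = int01 (fun x => w x + 2 * a) by rewrite Ew.
rewrite !int01D ?int01Z ?int01_cst //; last 3 first.
- by move=> x; exact: cvg_cst.
- by move=> x; exact: cvg_cst.
- by move=> x; apply: cvgM; [exact: cvg_cst|exact: ci].
rewrite -/a => E.
have w0 x : 0 <= w x by rewrite /w mulr_ge0 ?sqr_ge0 // invr_ge0 ltW.
have pw : periodic w 1 by move=> x; rewrite /w pv.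
have : 0 < int01 w.
  rewrite lt0r; apply/andP; split; last first.
    by rewrite -(int01_cst 0); apply: int01_le => // x; exact: cvg_cst.
  apply/eqP => I0; apply: nv; exists a => x.
  have /eqP := int01_periodic_eq0 cw pw w0 I0 x.
  by rewrite /w mulf_eq0 invr_eq0 (gt_eqF (v0 x)) orbF sqrf_eq0 subr_eq0 => /eqP.
rewrite -div1r ltr_pdivrMr // => Iw.
by rewrite -(ltr_pM2l a0) mulr1 mulrA -expr2; lra.
Qed.

End means.

(** * The speed as a function of the mass *)

Section waves_and_profiles.
Context {R : realType} {n : nat} (g : R -> R) (A B L : R).
Context (pg : periodic g 1) (gL : forall x y, `|g x - g y| <= L * `|x - y|).
Context (gAB : forall x, A <= g x <= B) (A0 : 0 < A).
Implicit Types (chi v : R -> R) (a b m r s x y z c e : R) (p : 'rV[R]_n).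

Let AB : A <= B.
Proof. by have /andP[] := gAB 0; apply: le_trans. Qed.

Let B0 : 0 < B. Proof. exact: lt_le_trans AB. Qed.

Let L0 : 0 <= L.
Proof. by have := gL 1 0; rewrite subr0 normr1 mulr1; apply: le_trans. Qed.

Let g0 x : 0 < g x. Proof. by apply: (lt_le_trans A0); case/andP: (gAB x). Qed.

Lemma lip_continuous : continuous g.
Proof.
move=> x; apply/cvgrPdist_lt => e e0.
have L1 : 0 < L + 1 by rewrite ltr_wpDl.
near=> y; apply: (le_lt_trans (gL x y)).
apply: (@le_lt_trans _ _ ((L + 1) * `|x - y|)).
  by rewrite ler_wpM2r // lerDl.
rewrite mulrC -ltr_pdivlMr //; near: y.
by apply: cvgr_dist_lt => //; exact: divr_gt0.
Unshelve. all: by end_near. Qed.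

Let cg := lip_continuous.

Definition wave_of m : R -> R := xget (fun=> 0) [set v | wave g m v].

Lemma wave_ofP m : 0 <= m -> wave g m (wave_of m).
Proof.
move=> m0; suff [v wv] : exists v, wave g m v.
  by rewrite /wave_of; apply: (xgetPex _ (ex_intro _ v wv)).
move: m0; rewrite le_eqVlt => /predU1P[<-|m0].
  by exists g; exact: wave_at0.
exact: wave_exists_pos gAB A0 m0.
Qed.

Local Notation V := wave_of.

Definition speed m := (int01 (fun y => (V m y)^-1))^-1.

Lemma wave_of_ge m x : 0 <= m -> A <= V m x.
Proof. by move=> m0; case/andP: (wave_bounds m0 gAB (wave_ofP m0) x). Qed.

Lemma wave_of_le m x : 0 <= m -> V m x <= B.
Proof. by move=> m0; case/andP: (wave_bounds m0 gAB (wave_ofP m0) x). Qed.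

Lemma wave_of_gt0 m x : 0 <= m -> 0 < V m x.
Proof. by move=> /wave_ofP[]. Qed.

Lemma wave_of0 : V 0 = g.
Proof. exact: wave0 (wave_ofP (lexx 0)). Qed.

Let J m := int01 (fun y => (V m y)^-1).

Let J_gt0 m : 0 <= m -> 0 < J m.
Proof. by move=> /wave_ofP[? ? ? _]; exact: int01_inv_gt0. Qed.

Let cVi m : 0 <= m -> continuous (fun x => (V m x)^-1).
Proof. by move=> /wave_ofP[? ? ? _]; exact: continuous_inv. Qed.

Lemma speed_between m a b : 0 <= m -> 0 < a -> (forall x, a <= V m x <= b) ->
  a <= speed m <= b.
Proof.
move=> m0 a0 Vab.
have b0 : 0 < b by have /andP[/le_trans h /h] := Vab 0; apply: lt_le_trans.
have : b^-1 <= J m <= a^-1.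
  apply: int01_between => [|x]; first exact: cVi.
  by have /andP[h1 h2] := Vab x; rewrite !lef_pV2 ?posrE ?wave_of_gt0 // h1 h2.
move=> /andP[h1 h2]; rewrite /speed -/(J m).
by rewrite -(invrK a) -(invrK b) !lef_pV2 ?posrE ?invr_gt0 ?J_gt0 // h1 h2.
Qed.

Lemma speed_bounds m : 0 <= m -> A <= speed m <= B.
Proof.
move=> m0; apply: speed_between => // x.
by rewrite wave_of_ge // wave_of_le.
Qed.

Lemma speed_gt0 m : 0 <= m -> 0 < speed m.
Proof. by move=> m0; rewrite invr_gt0 J_gt0. Qed.

(** With [D] as in [wave_gap] and [k = (m2 - m1) / 2],
[1 / v1 - 1 / v2 - k (ln D)'] equals
[(v2 - v1)^2 (m2 v2 + m1 v1) / (2 v1 v2 D) >= 0], and [ln D] is periodic. *)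
Lemma speed_le m1 m2 : 0 <= m1 -> m1 <= m2 -> speed m1 <= speed m2.
Proof.
rewrite [m1 <= m2]le_eqVlt => m1_0 /predU1P[->//|m12].
have m2_0 : 0 < m2 by exact: le_lt_trans m12.
have w1 := wave_ofP m1_0; have w2 := wave_ofP (ltW m2_0).
rewrite /speed lef_pV2 ?posrE ?J_gt0 ?(ltW m2_0) //.
pose v1 := V m1; pose v2 := V m2; rewrite -/v1 -/v2 in w1 w2 *.
have [p1 c1 v1_0 d1] := w1; have [p2 c2 v2_0 d2] := w2.
pose D y := m2 / 2 * v2 y ^+ 2 - m1 / 2 * v1 y ^+ 2.
have D0 x : 0 < D x.
  have mm : 0 <= m1 <= m2 by rewrite m1_0 ltW.
  have /andP[h _] := wave_gap mm A0 gAB w1 w2 x; apply: lt_le_trans h.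
  by rewrite mulr_gt0 ?exprn_gt0 // divr_gt0 // subr_gt0.
have dD x : has_deriv D x (v2 x - v1 x).
  by apply: hd_eq; [exact: hdB|ring].
have [F dF FE] := int01_primitive (continuous_inv c1 v1_0).
have [G dG GE] := int01_primitive (continuous_inv c2 v2_0).
rewrite -subr_ge0 FE GE.
pose k := (m2 - m1) / 2.
have := @deriv_ge0_homo R (fun x => F x - G x - k * ln (D x)).
move=> /(_ (fun x => (v1 x)^-1 - (v2 x)^-1 - k * ((D x)^-1 * (v2 x - v1 x)))).
have -> : F 1 - F 0 - (G 1 - G 0) =
    (F 1 - G 1 - k * ln (D 1)) - (F 0 - G 0 - k * ln (D 0)).
  have -> : D 1 = D 0 by rewrite /D -(add0r 1) p1 p2.
  by ring.
rewrite subr_ge0 => /(_ _ _ 0 1 ler01); apply.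
  move=> x; apply: hdB; first exact: hdB.
  by apply: hdZ; apply: hd_comp => //; exact: is_derive1_ln.
move=> x.
have -> : (v1 x)^-1 - (v2 x)^-1 - k * ((D x)^-1 * (v2 x - v1 x)) =
    (v2 x - v1 x) ^+ 2 * (m2 * v2 x + m1 * v1 x) / (2 * v1 x * v2 x * D x).
  have := D0 x; rewrite /k /D => Dx.
  by field; rewrite !gt_eqF //; lra.
have hv : 0 <= m2 * v2 x + m1 * v1 x.
  by rewrite addr_ge0 // mulr_ge0 // ltW.
apply: divr_ge0; first by rewrite mulr_ge0 ?sqr_ge0.
by rewrite !mulr_ge0 // ltW.
Qed.

(** [wave_gap] bounds [v2^2 / v1^2] by [1 + e], hence [v2 / v1] as well. *)
Lemma speed_growth m1 m2 : 0 < m1 -> m1 <= m2 ->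
  speed m2 <= (1 + (m2 - m1) / m2 * (B ^+ 2 / A ^+ 2)) * speed m1.
Proof.
move=> m1_0 m12; have m2_0 : 0 < m2 by exact: lt_le_trans m12.
have w1 := wave_ofP (ltW m1_0); have w2 := wave_ofP (ltW m2_0).
set e := _ / m2 * _.
have e0 : 0 <= e.
  by rewrite /e mulr_ge0 // divr_ge0 ?sqr_ge0 ?subr_ge0 // ltW.
have e1 : 0 < 1 + e by rewrite ltr_wpDr.
have V21 x : V m2 x <= (1 + e) * V m1 x.
  have v1 := wave_of_gt0 x (ltW m1_0); have v2 := wave_of_gt0 x (ltW m2_0).
  have mm : 0 <= m1 <= m2 by rewrite m12 ltW.
  have /andP[_ h] := wave_gap mm A0 gAB w1 w2 x.
  rewrite -ler_sqr ?nnegrE ?(ltW v2) ?mulr_ge0 ?(ltW e1) ?(ltW v1) //.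
  rewrite exprMn; apply: (@le_trans _ _ ((1 + e) * V m1 x ^+ 2)); last first.
    by rewrite ler_wpM2r ?sqr_ge0 // expr2 ler_peMr ?(ltW e1) // lerDl.
  have hA : A ^+ 2 <= V m1 x ^+ 2.
    by rewrite ler_sqr ?nnegrE ?(ltW A0) ?(ltW v1) // wave_of_ge // ltW.
  have hh : (m2 - m1) * B ^+ 2 <= m2 * e * V m1 x ^+ 2.
    have -> : m2 * e * V m1 x ^+ 2 = (m2 - m1) * B ^+ 2 * (V m1 x ^+ 2 / A ^+ 2).
      by rewrite /e; field; rewrite !gt_eqF.
    rewrite ler_peMr //; first by rewrite mulr_ge0 ?sqr_ge0 // subr_ge0.
    by rewrite ler_pdivlMr ?exprn_gt0 // mul1r.
  rewrite -(ler_pM2l m2_0).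
  have : m1 * V m1 x ^+ 2 <= m2 * V m1 x ^+ 2 by rewrite ler_wpM2r ?sqr_ge0.
  by lra.
rewrite /speed -/(J m1) -/(J m2) ler_pdivlMr ?J_gt0 ?(ltW m1_0) //.
rewrite mulrC -ler_pdivlMr ?invr_gt0 ?J_gt0 ?(ltW m2_0) // invrK.
rewrite /J -int01Z; last by exact: cVi (ltW m2_0).
apply: int01_le => [||x].
- exact: cVi (ltW m1_0).
- by move=> x; apply: cvgM; [exact: cvg_cst|exact: (cVi (ltW m2_0))].
have v1 := wave_of_gt0 x (ltW m1_0); have v2 := wave_of_gt0 x (ltW m2_0).
by rewrite ler_pdivlMr // mulrC ler_pdivrMr.
Qed.

(** Where [v - g] is maximal, [v] cannot grow faster than [g] to the right, so
[v' <= L] there; but [v' = (v - g) / (m v)]. *)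
Lemma wave_near0 m x : 0 <= m -> `|V m x - g x| <= m * B * L.
Proof.
rewrite le_eqVlt => /predU1P[<-|m0].
  by rewrite wave_of0 subrr normr0 !mul0r.
have wm := wave_ofP (ltW m0); have [pv cv v0 _] := wm.
have dv y := wave_deriv y m0 wm.
have pe : periodic (fun y => V m y - g y) 1 by move=> y; rewrite pv pg.
have ce : continuous (fun y => V m y - g y).
  by move=> y; apply: cvgB; [exact: cv|exact: cg].
have bnd y : V m y * L <= B * L by rewrite ler_wpM2r // wave_of_le // ltW.
(* The linear correction turns the one-sided bound on the increments of [v] into
   a one-sided maximum. *)
have hdl k y : has_deriv (fun z => k * (z - y)) y k.
  apply: hd_eq; first by apply: hdZ; apply: hdB; [exact: hd_id|exact: hd_cst].
  by rewrite subr0 mulr1.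
have gLr y z : y <= z -> - (L * (z - y)) <= g z - g y <= L * (z - y).
  by move=> yz; have := gL z y; rewrite (ger0_norm (x := z - y)) ?subr_ge0 // ler_norml.
rewrite ler_norml; apply/andP; split.
  have [x0 mx] := periodic_argmin pe ce.
  have : - ((V m x0 - g x0) / (m * V m x0)) - L <= 0.
    apply: (hd_right_max (hdB (hdN (dv x0)) (hdl L x0)) ltr01) => y /andP[xy _].
    by have := mx y; have /andP[] := gLr _ _ xy; rewrite subrr; lra.
  have := mx x; have := bnd x0; move: (v0 x0).
  rewrite /= => vx0 h1 h2 h3.
  have : - ((V m x0 - g x0) / (m * V m x0)) <= L by lra.
  rewrite -mulNr ler_pdivrMr ?mulr_gt0 // => h4.
  have : m * (V m x0 * L) <= m * (B * L) by rewrite ler_pM2l.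
  lra.
have [x0 mx] := periodic_argmax pe ce.
have : (V m x0 - g x0) / (m * V m x0) - L <= 0.
  apply: (hd_right_max (hdB (dv x0) (hdl L x0)) ltr01) => y /andP[xy _].
  by have := mx y; have /andP[] := gLr _ _ xy; rewrite subrr; lra.
have := mx x; have := bnd x0; move: (v0 x0).
rewrite /= => vx0 h1 h2 h3.
have : ((V m x0 - g x0) / (m * V m x0)) <= L by lra.
rewrite ler_pdivrMr ?mulr_gt0 // => h4.
have : m * (V m x0 * L) <= m * (B * L) by rewrite ler_pM2l.
lra.
Qed.

Lemma speed_near0 m : 0 <= m ->
  speed m - speed 0 <= m * (B * L * B ^+ 2 / A ^+ 2).
Proof.
move=> m0; have z0 := lexx (0 : R).
set k := B * L / A ^+ 2.
have k0 : 0 <= k by rewrite /k divr_ge0 ?sqr_ge0 // mulr_ge0 // ltW.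
have J01 : J 0 <= J m + m * k.
  rewrite -(int01_cst (m * k)) -int01D; [|exact: cVi|by move=> x; exact: cvg_cst].
  apply: int01_le => [||x]; first exact: cVi.
    by move=> x; apply: cvgD; [exact: (cVi m0)|exact: cvg_cst].
  rewrite wave_of0 -lerBlDl.
  have gx : 0 < g x by apply: (lt_le_trans A0); case/andP: (gAB x).
  have vx := wave_of_gt0 x m0.
  have -> : (g x)^-1 - (V m x)^-1 = (V m x - g x) / (g x * V m x).
    by field; rewrite !gt_eqF.
  rewrite ler_pdivrMr ?mulr_gt0 //.
  apply: (le_trans (ler_norm _)); apply: (le_trans (wave_near0 x m0)).
  have -> : m * B * L = m * k * (A * A) by rewrite /k; field; rewrite gt_eqF.
  apply: ler_wpM2l; first exact: mulr_ge0.
  apply: ler_pM; rewrite ?(ltW A0) //; last exact: wave_of_ge.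
  by case/andP: (gAB x).
have Jm := J_gt0 m0; have J0 := J_gt0 z0.
have -> : speed m - speed 0 = (J 0 - J m) * (speed m * speed 0).
  by rewrite /speed -/(J m) -/(J 0); field; rewrite !gt_eqF.
have /andP[s1 s2] := speed_bounds m0; have /andP[s3 s4] := speed_bounds z0.
have s0 : 0 <= speed m * speed 0 by rewrite mulr_ge0 // ltW // speed_gt0.
apply: (@le_trans _ _ (m * k * (speed m * speed 0))).
  by rewrite ler_wpM2r //; lra.
have -> : m * (B * L * B ^+ 2 / A ^+ 2) = m * k * (B * B).
  by rewrite /k; field; rewrite gt_eqF.
apply: ler_wpM2l; first exact: mulr_ge0.
by apply: ler_pM => //; apply/ltW/speed_gt0.
Qed.

Lemma int01_wave m : 0 <= m -> int01 (V m) = int01 g.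
Proof.
move=> m0; have [pv cv v0 dv] := wave_ofP m0.
apply/eqP; rewrite -subr_eq0 -mulN1r -int01Z // -int01D //; last first.
  by move=> x; apply: cvgM; [exact: cvg_cst|exact: cg].
rewrite /int01 (@Rint01E _ (fun y => m / 2 * V m y ^+ 2)).
- by rewrite -(add0r 1) pv subrr.
- by move=> x; apply: cvgD; [exact: cv|apply: cvgM; [exact: cvg_cst|exact: cg]].
- by move=> x; rewrite mulN1r.
Qed.

(** The slope [(v - g) / (m v)] is [O(1 / m)], and both the mean of [v], which
is that of [g], and the speed lie between the extreme values of [v]. *)
Lemma wave_far m : 0 < m -> (forall x, `|V m x - int01 g| <= B / A / m) /\
  `|speed m - int01 g| <= B / A / m.
Proof.
move=> m0; have wm := wave_ofP (ltW m0); have [pv cv v0 _] := wm.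
have dv y := wave_deriv y m0 wm.
set o := B / A / m.
have o0 : 0 <= o by rewrite /o !divr_ge0 // ltW.
have bnd x : `|(V m x - g x) / (m * V m x)| <= o.
  have vA := wave_of_ge x (ltW m0); have vB := wave_of_le x (ltW m0).
  have /andP[gA gB] := gAB x.
  rewrite normrM normfV (gtr0_norm (x := m * _)) ?mulr_gt0 //.
  rewrite ler_pdivrMr ?mulr_gt0 //.
  have -> : o * (m * V m x) = B * (V m x / A) by rewrite /o; field; rewrite !gt_eqF.
  apply: (@le_trans _ _ B); first by rewrite ler_norml; have := A0; lra.
  by rewrite ler_peMr ?(ltW B0) // ler_pdivlMr // mul1r.
have osc x y : `|V m x - V m y| <= o.
  have [k /andP[k0 k1]] := unit_repr x; have [l /andP[l0 l1]] := unit_repr y.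
  rewrite -(subrK k%:~R x) -(subrK l%:~R y) !periodic_int //.
  apply: (le_trans (deriv_le_bound _ _ dv bnd)).
  by rewrite ler_piMr // ler_norml; lra.
have oscI x y : V m x - o <= V m y <= V m x + o.
  by have := osc x y; rewrite ler_norml; lra.
split=> [x|].
  have /andP[] := int01_between cv (oscI x).
  by rewrite (int01_wave (ltW m0)) ler_norml; lra.
have [x1 mx] := periodic_argmax pv cv.
have [x0 mn] := periodic_argmin pv cv.
have mm x : V m x0 <= V m x <= V m x1 by rewrite mn mx.
have := speed_between (ltW m0) (v0 x0) mm.
have := int01_between cv mm; rewrite (int01_wave (ltW m0)).
by have := osc x1 x0; rewrite !ler_norml; lra.
Qed.

Lemma speed_lt_mean m : ~ (exists a, forall x, g x = a) -> 0 <= m -> speed m < int01 g.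
Proof.
move=> ng m0; have [pv cv v0 dv] := wave_ofP m0.
rewrite -(int01_wave m0); apply: harmonic_lt_mean => // -[a Va].
apply: ng; exists a => x; rewrite -(Va x).
apply/eqP; rewrite eq_sym -subr_eq0; apply/eqP; apply: hd_uniq (dv x) _.
rewrite (_ : (fun _ => _) = fun=> m / 2 * a ^+ 2); first exact: hd_cst.
by apply/funext => y; rewrite Va.
Qed.

Lemma speed_continuous m : 0 < m -> {for m, continuous speed}.
Proof.
move=> m0; apply/cvgrPdist_le => e e0.
pose K := B * (B ^+ 2 / A ^+ 2) / (m / 2).
have K0 : 0 < K by rewrite /K !(divr_gt0, mulr_gt0, exprn_gt0).
have lip a b : m / 2 < a -> a <= b -> `|speed b - speed a| <= K * `|b - a|.
  move=> ma ab; have a0 : 0 < a by apply: lt_trans ma; rewrite divr_gt0.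
  have b0 := lt_le_trans a0 ab.
  rewrite !ger0_norm ?subr_ge0 // ?speed_le ?(ltW a0) //.
  apply: (le_trans (y := (b - a) / b * (B ^+ 2 / A ^+ 2) * speed a)).
    by have := speed_growth a0 ab; lra.
  have /andP[_ sB] := speed_bounds (ltW a0).
  apply: (le_trans (y := (b - a) / b * (B ^+ 2 / A ^+ 2) * B)).
    rewrite ler_wpM2l // mulr_ge0 ?divr_ge0 ?sqr_ge0 ?subr_ge0 //; exact: ltW.
  have -> : (b - a) / b * (B ^+ 2 / A ^+ 2) * B = B * (B ^+ 2 / A ^+ 2) * b^-1 * (b - a).
    by ring.
  rewrite ler_wpM2r ?subr_ge0 // /K ler_wpM2l //.
    by rewrite mulr_ge0 ?divr_ge0 ?sqr_ge0 // ltW.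
  by rewrite lef_pV2 ?posrE ?divr_gt0 // ltW // (lt_le_trans ma).
near=> x.
have mx : m / 2 < x.
  by near: x; apply: lt_nbhsr; rewrite ltr_pdivrMr // mulr_natr mulr2n ltrDl.
have mm : m / 2 < m by rewrite ltr_pdivrMr // mulr_natr mulr2n ltrDl.
have dx : `|m - x| <= e / K.
  by near: x; apply: cvgr_dist_le => //; rewrite divr_gt0.
have Kd : K * `|m - x| <= e by rewrite mulrC -ler_pdivlMr.
have [xm|/ltW xm] := leP x m; first exact: le_trans (lip _ _ mx xm) Kd.
by rewrite distrC; apply: le_trans (lip _ _ mm xm) _; rewrite distrC.
Unshelve. all: by end_near. Qed.

(** [m * speed m ^ 2] is the squared norm of the [p] whose profiles have mass
[m]. *)
Lemma radius_inj m1 m2 : 0 <= m1 -> 0 <= m2 ->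
  m1 * speed m1 ^+ 2 = m2 * speed m2 ^+ 2 -> m1 = m2.
Proof.
wlog m12 : m1 m2 / m1 <= m2 => [H|].
  by have [/H//|/ltW m21 h1 h2 /esym/(H _ _ m21 h2 h1)] := leP m1 m2.
move=> m1_0 m2_0 E; apply/le_anti; rewrite m12 /= -(@ler_pM2r _ (speed m1 ^+ 2)).
  rewrite E ler_wpM2l // ler_sqr ?nnegrE ?speed_le // ltW // speed_gt0 //.
by rewrite exprn_gt0 // speed_gt0.
Qed.

(** As the speed stays between [A] and [B], the solution is to be found between
[r^2 / B^2] and [r^2 / A^2]. *)
Lemma radius_surj r : 0 <= r -> exists2 m, 0 <= m & m * speed m ^+ 2 = r ^+ 2.
Proof.
rewrite le_eqVlt => /predU1P[<-|r0]; first by exists 0; rewrite ?mul0r ?expr0n.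
pose a := r ^+ 2 / B ^+ 2; pose b := r ^+ 2 / A ^+ 2.
have a0 : 0 < a by rewrite divr_gt0 // exprn_gt0.
have b0 : 0 < b by rewrite divr_gt0 // exprn_gt0.
have ab : a <= b.
  by rewrite ler_pM2l ?exprn_gt0 // lef_pV2 ?posrE ?exprn_gt0 //
    ler_sqr ?nnegrE ?(ltW A0) ?(ltW B0).
have := @IVT R (fun m => m * speed m ^+ 2) a b (r ^+ 2) ab.
case.
- apply: continuous_in_subspaceT => x; rewrite inE /= in_itv /= => /andP[ax _].
  apply: cvgM; first exact: cvg_id.
  by apply: continuous_sqr_at; apply: speed_continuous; apply: lt_le_trans ax.
- have sA (m : R) : 0 < m -> A ^+ 2 <= speed m ^+ 2 <= B ^+ 2.
    move=> /ltW m0; have /andP[h1 h2] := speed_bounds m0.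
    by rewrite !ler_sqr ?nnegrE ?h1 ?h2 ?(ltW (speed_gt0 m0)) ?(ltW A0) ?(ltW B0).
  have /andP[_ h1] := sA _ a0; have /andP[h2 _] := sA _ b0.
  rewrite ge_min le_max; apply/andP; split; apply/orP; [left|right].
    apply: (@le_trans _ _ (a * B ^+ 2)); first by rewrite ler_pM2l.
    by rewrite /a divfK // gt_eqF // exprn_gt0.
  apply: (@le_trans _ _ (b * A ^+ 2)); last by rewrite ler_pM2l.
  by rewrite /b divfK // gt_eqF // exprn_gt0.
- move=> m; rewrite in_itv /= => /andP[am _] E; exists m => //.
  exact: le_trans (ltW a0) am.
Qed.


(** * Every profile is the flow of a wave *)

Definition mass r : R := xget 0 [set m | 0 <= m /\ m * speed m ^+ 2 = r ^+ 2].
Definition cbar r : R := speed (mass r).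

Lemma massP r : 0 <= r -> 0 <= mass r /\ mass r * cbar r ^+ 2 = r ^+ 2.
Proof.
move=> r0; have [m m0 E] := radius_surj r0.
have h : [set m | 0 <= m /\ m * speed m ^+ 2 = r ^+ 2] m by [].
exact: (xgetPex 0 (ex_intro _ m h)).
Qed.

Lemma mass_ge0 r : 0 <= r -> 0 <= mass r. Proof. by move=> /massP[]. Qed.

Lemma mass_uniq m r : 0 <= r -> 0 <= m -> m * speed m ^+ 2 = r ^+ 2 -> m = mass r.
Proof.
move=> r0 m0 E; have [M0 ME] := massP r0.
by apply: (radius_inj) => //; rewrite E -ME.
Qed.

Lemma enorm_ge0 p : 0 <= enorm p. Proof. exact: sqrtr_ge0. Qed.

Lemma enorm_eq0 p : (enorm p == 0) = (p == 0).
Proof.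
rewrite sqrtr_eq0; apply/idP/eqP => [h|->]; last first.
  by rewrite big1 // => i _; rewrite mxE expr0n.
have /eqP : \sum_i p ord0 i ^+ 2 = 0.
  by apply/le_anti; rewrite h sumr_ge0 // => i _; exact: sqr_ge0.
rewrite psumr_eq0 => [/allP hp|i _]; last exact: sqr_ge0.
apply/rowP => i; rewrite mxE; apply/eqP.
by have := hp i (mem_index_enum i); rewrite sqrf_eq0.
Qed.

Lemma lift_int chi z (k : int) : (forall z, chi (z + 1) = chi z + 1) ->
  chi (z + k%:~R) = chi z + k%:~R.
Proof.
move=> cS; have := @periodic_int R (fun y => chi y - y) z k.
have pc : periodic (fun y => chi y - y) 1 by move=> y; rewrite cS; ring.
by move=> /(_ pc); lra.
Qed.

Lemma lift_deriv chi z d (k : int) : (forall z, chi (z + 1) = chi z + 1) ->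
  has_deriv chi z d -> has_deriv chi (z + k%:~R) d.
Proof.
move=> cS dz; have -> : chi = (fun y => chi (y + - k%:~R) + k%:~R).
  apply/funext => y; have := lift_int (y + - k%:~R) k cS.
  by rewrite subrK => ->.
apply: hd_eq; last exact: addr0.
by apply: hdD; [apply: hd_shift; rewrite addrK; exact: dz|exact: hd_cst].
Qed.

(** The right derivative at 0 and the left derivative at 1 are glued by the
relation [chi (z + 1) = chi z + 1]. *)
Lemma profile_derivable p c chi : profile g p c chi ->
  forall z, has_deriv chi z (derive1 chi z).
Proof.
move=> [[ode _ [d [dr dl]]] _ cS].
have dpt z d' : has_deriv chi z d' -> has_deriv chi z (derive1 chi z).
  by move=> h; rewrite (hd_derive1 h).
have d0 : has_deriv chi 0 d.
  have cv : h^-1 *: ((chi \o shift 0) (h *: (1 : R)) - chi 0) @[h --> 0^'] --> d.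
    have -> : (fun h => h^-1 *: ((chi \o shift 0) (h *: (1 : R)) - chi 0)) =
        (fun h : R => h^-1 * (chi h - chi 0)).
      by apply/funext => h /=; rewrite addr0 /GRing.scale /= mulr1.
    apply: (@cvg_at_right_left_dnbhs R R^o); first exact: dr.
    rewrite (_ : (fun h : R => _) = (fun h => h^-1 * (chi (1 + h) - chi 1))) //.
    apply/funext => h; congr (_ * _).
    by have := cS 0; rewrite add0r (addrC 1 h) cS => ->; ring.
  by apply: DeriveDef; [apply/cvg_ex; exists d|exact: cvg_lim cv].
move=> z; have [k /andP[k0 k1]] := unit_repr z.
suff [d' hd'] : exists d', has_deriv chi (z - k%:~R) d'.
  by apply: (dpt _ d'); rewrite -(subrK (k%:~R) z); exact: lift_deriv.
move: k0; rewrite le_eqVlt => /predU1P[<-|k0]; first by exists d.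
exists ('D_1 chi (z - k%:~R)); apply: derivableP.
by case: (ode (z - k%:~R)); rewrite ?in_itv /= ?k0.
Qed.

(** On (0, 1) the function [|p|^2 chi' - c chi + G] has zero derivative, whatever
[p]. Its constancy is an equation between derivatives, [|p|^2 chi - Psi] having
derivative zero, so it holds at 0 and 1 too; comparing these two points gives
[G 1 - G 0 = c], which makes both sides of the identity periodic. *)
Lemma profile_first_integral p c chi : profile g p c chi -> exists G K,
  [/\ forall z, has_deriv G z (g (chi z)), G 1 - G 0 = c &
      forall z, enorm p ^+ 2 * derive1 chi z = c * chi z - G z + K].
Proof.
move=> hp; have dchi := profile_derivable hp; have [[ode _ _] _ cS] := hp.
have cgc : continuous (fun z => g (chi z)).
  move=> z; apply: (@continuous_comp _ _ _ chi g); last exact: cg.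
  exact: hd_continuous dchi z.
have [G dG] := continuous_primitive cgc.
set a2 := enorm p ^+ 2.
have pd : periodic (derive1 chi) 1.
  by move=> z; apply: hd_derive1; exact: (lift_deriv 1 cS (dchi z)).
pose E z := a2 * derive1 chi z - (c * chi z - G z).
have dE z : z \in `]0, 1[ -> has_deriv E z 0.
  move=> z01; have [_ h2 h3] := ode z z01.
  have d2 : has_deriv (fun y => a2 * derive1 chi y) z (c * derive1 chi z - g (chi z)).
    have [p0|p0] := eqVneq p 0.
      have a20 : a2 = 0 by rewrite /a2 (eqP (_ : enorm p == 0)) ?enorm_eq0 ?p0 ?expr0n.
      have -> : c * derive1 chi z - g (chi z) = 0 by move: h3; rewrite -/a2 a20; lra.
      rewrite a20.
      rewrite (_ : (fun _ => _) = fun=> 0); first exact: hd_cst.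
      by apply/funext => y; rewrite mul0r.
    apply: hd_eq; first by apply: hdZ; apply: derivableP; exact: h2.
    by rewrite -derive1E mulrC; move: h3; rewrite -/a2; lra.
  apply: hd_eq; first by apply: hdB d2 _; apply: hdB; [exact: hdZ (dchi z)|exact: dG].
  by ring.
pose K := E (2^-1).
have E01 z : z \in `]0, 1[ -> E z = K.
  by move=> z01; apply: (deriv0_open dE) => //; rewrite in_itv /=; lra.
have cPsi : continuous (fun z => c * chi z - G z + K).
  move=> z; apply: hd_continuous_at.
  by apply: hdD; [apply: hdB; [exact: hdZ (dchi z)|exact: dG]|exact: hd_cst].
have [Psi dPsi] := continuous_primitive cPsi.
(* [Psi] is a primitive of the right-hand side, so the identity states that
   [a2 * chi - Psi] has zero derivative. *)
have Ecl z : z \in `[0, 1] -> a2 * derive1 chi z = c * chi z - G z + K.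
  move=> z01; apply/eqP; rewrite -subr_eq0; apply/eqP; move: z z01.
  apply: (@deriv0_closure R (fun z => a2 * chi z - Psi z)) => [|z|z /E01].
  - exact: ltr01.
  - by apply: hdB; [exact: hdZ (dchi z)|exact: dPsi].
  - by rewrite /E; lra.
have G10 : G 1 - G 0 = c.
  have := Ecl 0; have := Ecl 1; rewrite !in_itv /= !lexx ler01 => /(_ isT) e1 /(_ isT) e0.
  have := cS 0; have := pd 0; rewrite !add0r => pd0 cS0.
  by move: e1; rewrite pd0 e0 cS0; lra.
exists G, K; split => // z.
have GS y : G (y + 1) - G y = c.
  rewrite -G10 -[1 in RHS]add0r.
  by apply: (periodic_primitive _ _ dG) => x; rewrite cS pg.
pose F y := a2 * derive1 chi y - (c * chi y - G y + K).
have pF : periodic F 1.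
  by move=> y; rewrite /F pd cS; have := GS y; lra.
have [k /andP[k0 k1]] := unit_repr z.
have : F z = 0.
  rewrite -(subrK (k%:~R) z) periodic_int // /F Ecl ?subrr //.
  by rewrite in_itv /= k0 ltW.
by rewrite /F; lra.
Qed.

(** [H] is the time of the flow [y' = v y]. *)
Lemma flow_time v H chi c z : (forall x, 0 < v x) ->
  (forall x, has_deriv H x (v x)^-1) ->
  (forall z, has_deriv chi z (v (chi z) / c)) -> H (chi z) = H (chi 0) + z / c.
Proof.
move=> v0 dH dchi.
have -> : H (chi 0) = H (chi 0) - 0 / c by rewrite mul0r subr0.
apply/eqP; rewrite -subr_eq; apply/eqP.
apply: (deriv0_cst (F := fun z => H (chi z) - z / c)) => y.
apply: hd_eq.
  apply: hdB; first by apply: hd_comp; [exact: dH|exact: dchi].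
  by apply: hdM; [exact: hd_id|exact: hd_cst].
by rewrite mulr0 addr0 mul1r mulKf ?subrr // gt_eqF.
Qed.

(** At a zero of [e' = chi' (c chi' - V (chi))] the energy gap [e] vanishes, because
[chi' > 0]: where [chi'] is minimal, [chi'' = 0], so [c chi' = g (chi) > 0]. *)
Lemma profile_flow p c chi : profile g p c chi ->
  [/\ 0 < c, c = cbar (enorm p) &
     forall z, has_deriv chi z (V (mass (enorm p)) (chi z) / c)].
Proof.
move=> hp; have dchi := profile_derivable hp; have [_ _ cS] := hp.
have [G [K [dG G10 E]]] := profile_first_integral hp.
set a := enorm p in E *; have a_ge0 : 0 <= a by exact: enorm_ge0.
have c0 : 0 < c.
  rewrite -G10 subr_gt0; apply: (deriv_gt0_homo dG) => // z; exact: g0.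
pose m := a ^+ 2 / c ^+ 2.
have m0 : 0 <= m by rewrite divr_ge0 ?sqr_ge0.
have [pV cV V0 dV] := wave_ofP m0.
have pd : periodic (derive1 chi) 1.
  by move=> z; apply: hd_derive1; exact: (lift_deriv 1 cS (dchi z)).
have gchi z : g (chi (z + 1)) = g (chi z).
  by rewrite cS pg.
have Vchi z : V m (chi (z + 1)) = V m (chi z).
  by rewrite cS pV.
have flow z : c * derive1 chi z = V m (chi z).
  have [a0|a0] := eqVneq a 0.
    rewrite /m a0 expr0n mul0r (wave_of0).
    apply/eqP; rewrite -subr_eq0; apply/eqP.
    apply: (@hd_uniq R (fun y => c * chi y - G y) z).
      by apply: hdB; [exact: hdZ (dchi z)|exact: dG].
    rewrite (_ : (fun _ => _) = fun=> - K); first exact: hd_cst.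
    by apply/funext => y; have := E y; rewrite a0 expr0n mul0r; lra.
  have a2 : 0 < a ^+ 2 by rewrite exprn_gt0 // lt0r a0.
  have m_gt0 : 0 < m by rewrite divr_gt0 // exprn_gt0.
  have ddchi y : has_deriv (derive1 chi) y ((c * derive1 chi y - g (chi y)) / a ^+ 2).
    have -> : derive1 chi = fun y => (a ^+ 2)^-1 * (c * chi y - G y + K).
      by apply/funext => x; rewrite -E mulrA mulVf ?mul1r // gt_eqF.
    apply: hd_eq.
      by apply: hdZ; apply: hdD; [apply: hdB; [exact: hdZ (dchi y)|exact: dG]|exact: hd_cst].
    by rewrite -E; field.
  have dpos y : 0 < derive1 chi y.
    have [x0 e0 mn] := periodic_crit_min pd ddchi.
    apply: (lt_le_trans _ (mn y)); rewrite -(pmulr_rgt0 _ c0).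
    have <- : g (chi x0) = c * derive1 chi x0 => //.
    apply/eqP; rewrite eq_sym -subr_eq0.
    by move/eqP: e0; rewrite mulf_eq0 invr_eq0 (gt_eqF a2) orbF.
  pose e y := m / 2 * (c * derive1 chi y) ^+ 2 - m / 2 * V m (chi y) ^+ 2.
  have de y : has_deriv e y (derive1 chi y * (c * derive1 chi y - V m (chi y))).
    apply: hd_eq.
      apply: hdB; first by apply: hdZ; apply: hd_sqr; apply: hdZ; exact: ddchi.
      exact: (@hd_comp R (fun x => m / 2 * V m x ^+ 2) chi y _ _ (dV (chi y)) (dchi y)).
    by rewrite /m; field; rewrite a0 gt_eqF.
  have pe : periodic e 1 by move=> y; rewrite /e pd Vchi.
  have crit y : derive1 chi y * (c * derive1 chi y - V m (chi y)) = 0 -> e y = 0.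
    move=> /eqP; rewrite mulf_eq0 gt_eqF //= subr_eq0 /e => /eqP ->.
    by rewrite subrr.
  have e0 : e z = 0.
    have [x1 /crit e1 mx] := periodic_crit_max pe de.
    have [x2 /crit e2 mn] := periodic_crit_min pe de.
    by apply/le_anti; rewrite -{1}e1 -e2 mx mn.
  apply/le_anti/andP; split; apply: (half_sqr_le m_gt0) => //; rewrite ?mulr_gt0 //;
    by move: e0; rewrite /e; lra.
have dflow z : has_deriv chi z (V m (chi z) / c).
  by apply: hd_eq; [exact: dchi|rewrite -flow mulrC mulKf // gt_eqF].
have [H dH HE] := int01_primitive (continuous_inv cV V0).
have Hz z := flow_time z V0 dH dflow.
have HS x : H (x + 1) - H x = H (0 + 1) - H 0.
  by apply: (periodic_primitive _ _ dH) => y; rewrite pV.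
have cm : c = speed m.
  rewrite /speed HE; apply: (canRL (invrK)).
  have := Hz 1; have := HS (chi 0); rewrite -cS !add0r div1r; lra.
have ma : m = mass a.
  by apply: mass_uniq => //; rewrite -cm /m divfK // sqrf_eq0 gt_eqF.
by split => //; [rewrite /cbar -ma|rewrite -ma].
Qed.


(** * Dependence of the speed on the norm of p *)

Lemma cbar_bounds r : 0 <= r -> A <= cbar r <= B.
Proof. by move=> /massP[m0 _]; exact: speed_bounds. Qed.

Lemma cbar_gt0 r : 0 <= r -> 0 < cbar r.
Proof. by move=> /cbar_bounds/andP[+ _]; exact: lt_le_trans. Qed.

Lemma mass_le r s : 0 <= r -> r <= s -> mass r <= mass s.
Proof.
move=> r0 rs; have s0 := le_trans r0 rs.
have [m0 mE] := massP r0; have [k0 kE] := massP s0.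
rewrite leNgt; apply/negP => h.
have : mass s * cbar s ^+ 2 < mass r * cbar r ^+ 2.
  apply: (@lt_le_trans _ _ (mass r * cbar s ^+ 2)).
    by rewrite ltr_pM2r // exprn_gt0 // cbar_gt0.
  rewrite ler_wpM2l // ler_sqr ?nnegrE ?(ltW (cbar_gt0 _)) //.
  exact: (speed_le k0 (ltW h)).
by rewrite kE mE ltr_sqr ?nnegrE // ltNge rs.
Qed.

Lemma cbar_le r s : 0 <= r -> r <= s -> cbar r <= cbar s.
Proof.
move=> r0 rs; have [m0 _] := massP r0.
exact: (speed_le m0 (mass_le r0 rs)).
Qed.

(** The quotient [cbar r / r] is the inverse square root of the mass. With
[cbar_le], this squeezes [cbar s] between [cbar r] and [cbar r * s / r]. *)
Lemma cbar_growth r s : 0 < r -> r <= s -> cbar s * r <= cbar r * s.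
Proof.
move=> r0 rs; have s0 := lt_le_trans r0 rs.
have [_ mE] := massP (ltW r0); have [_ kE] := massP (ltW s0).
have cr := cbar_gt0 (ltW r0); have cs := cbar_gt0 (ltW s0).
rewrite -ler_sqr ?nnegrE ?mulr_ge0 ?(ltW r0) ?(ltW s0) ?(ltW cr) ?(ltW cs) // !exprMn.
rewrite -mE -kE.
have h := mass_le (ltW r0) rs.
have -> : cbar s ^+ 2 * (mass r * cbar r ^+ 2) =
  cbar s ^+ 2 * cbar r ^+ 2 * mass r by ring.
have -> : cbar r ^+ 2 * (mass s * cbar s ^+ 2) =
  cbar s ^+ 2 * cbar r ^+ 2 * mass s by ring.
by rewrite ler_wpM2l // mulr_ge0 ?sqr_ge0.
Qed.

Lemma mass_ub r : 0 <= r -> mass r <= r ^+ 2 / A ^+ 2.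
Proof.
move=> r0; have [m0 mE] := massP r0; have /andP[h _] := cbar_bounds r0.
rewrite ler_pdivlMr ?exprn_gt0 // -mE ler_wpM2l // ler_sqr ?nnegrE ?(ltW A0) //.
by rewrite ltW // cbar_gt0.
Qed.

Lemma mass_lb r : 0 <= r -> r ^+ 2 / B ^+ 2 <= mass r.
Proof.
move=> r0; have [m0 mE] := massP r0; have /andP[_ h] := cbar_bounds r0.
rewrite ler_pdivrMr ?exprn_gt0 // -mE ler_wpM2l // ler_sqr ?nnegrE ?(ltW B0) //.
by rewrite ltW // cbar_gt0.
Qed.

Lemma mass0 : mass 0 = 0.
Proof.
have [m0 _] := massP (lexx 0); apply/le_anti; rewrite m0 andbT.
by have := mass_ub (lexx 0); rewrite expr0n mul0r.
Qed.

Lemma cbar0 : cbar 0 = (int01 (fun s => (g s)^-1))^-1.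
Proof. by rewrite /cbar mass0 /speed (wave_of0). Qed.

Lemma cbar_near0 : exists K, forall r, 0 <= r -> `|cbar r - cbar 0| <= K * r ^+ 2.
Proof.
exists ((B * L * B ^+ 2 / A ^+ 2) / A ^+ 2) => r r0.
have [m0 _] := massP r0.
rewrite ger0_norm ?subr_ge0 ?cbar_le //.
have := speed_near0 m0; rewrite {2}/cbar mass0 => /le_trans; apply.
set k := B * L * _ / _; have k0 : 0 <= k.
  by rewrite /k divr_ge0 ?sqr_ge0 // mulr_ge0 ?sqr_ge0 // mulr_ge0 // ltW.
apply: (@le_trans _ _ (r ^+ 2 / A ^+ 2 * k)); first by rewrite ler_wpM2r // mass_ub.
by rewrite le_eqVlt; apply/orP; left; apply/eqP; ring.
Qed.

Lemma cbar_right0 : cbar r @[r --> 0^'+] --> cbar 0.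
Proof.
have [K hK] := cbar_near0.
have K1 : 0 < `|K| + 1 by rewrite ltr_wpDl.
apply/cvgrPdist_le => e e0.
near=> r.
have r0 : 0 <= r by near: r; exact: nbhs_right_ge.
rewrite distrC; apply: (le_trans (hK _ r0)).
have r1 : r <= 1 by near: r; exact: nbhs_right_le.
have re : r <= e / (`|K| + 1) by near: r; apply: nbhs_right_le; exact: divr_gt0.
apply: (@le_trans _ _ ((`|K| + 1) * r)); last by rewrite mulrC -ler_pdivlMr.
have h1 : K <= `|K| + 1 by rewrite (le_trans (ler_norm _)) // lerDl.
apply: (@le_trans _ _ ((`|K| + 1) * r ^+ 2)); first by rewrite ler_wpM2r // sqr_ge0.
by rewrite ler_wpM2l ?(ltW K1) // expr2 ler_piMr.
Unshelve. all: by end_near. Qed.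

Lemma cbar_continuous_at r : 0 < r -> {for r, continuous (cbar)}.
Proof.
move=> r0; apply/cvgrPdist_le => e e0.
have lip a b : r / 2 < a -> a <= b -> `|cbar b - cbar a| <= 2 * B / r * `|b - a|.
  move=> ra ab; have a0 : 0 < a by apply: lt_trans ra; rewrite divr_gt0.
  have b0 := lt_le_trans a0 ab.
  rewrite !ger0_norm ?subr_ge0 ?cbar_le ?(ltW a0) //.
  have h := cbar_growth a0 ab.
  have /andP[_ h2] := cbar_bounds (ltW a0).
  rewrite -(ler_pM2r a0).
  apply: (@le_trans _ _ (cbar a * (b - a))); first by lra.
  have h3 : 1 <= 2 / r * a by rewrite mulrAC ler_pdivlMr // mul1r; lra.
  apply: (@le_trans _ _ (B * (b - a))); first by rewrite ler_wpM2r // subr_ge0.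
  have -> : 2 * B / r * (b - a) * a = B * (b - a) * (2 / r * a) by ring.
  by rewrite ler_peMr // mulr_ge0 ?subr_ge0 // ltW.
have rr : r / 2 < r by rewrite ltr_pdivrMr // mulr_natr mulr2n ltrDl.
have K0 : 0 < 2 * B / r by rewrite divr_gt0 // mulr_gt0.
near=> x.
have rx : r / 2 < x by near: x; exact: lt_nbhsr.
have dx : `|r - x| <= e / (2 * B / r).
  by near: x; apply: cvgr_dist_le => //; rewrite divr_gt0.
have Kd : 2 * B / r * `|r - x| <= e by rewrite mulrC -ler_pdivlMr.
have [xr|/ltW xr] := leP x r; first exact: le_trans (lip _ _ rx xr) Kd.
by rewrite distrC; apply: le_trans (lip _ _ rr xr) _; rewrite distrC.
Unshelve. all: by end_near. Qed.

Lemma cbar_continuous : {within [set r | 0 <= r], continuous (cbar)}.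
Proof.
have -> : [set r : R | 0 <= r] = `[0, +oo[%classic.
  by apply/seteqP; split => r /=; rewrite in_itv /= andbT.
apply/continuous_within_itvcyP; split; last exact: cbar_right0.
by move=> r; rewrite in_itv /= andbT; exact: cbar_continuous_at.
Qed.

Lemma far_bound r : 0 < r -> B / A / mass r <= B ^+ 3 / A / r ^+ 2.
Proof.
move=> r0; have h := mass_lb (ltW r0).
have r2 : 0 < r ^+ 2 / B ^+ 2 by rewrite divr_gt0 // exprn_gt0.
apply: (@le_trans _ _ (B / A / (r ^+ 2 / B ^+ 2))).
  rewrite ler_wpM2l ?divr_ge0 ?(ltW A0) ?(ltW B0) // lef_pV2 ?posrE //.
  exact: lt_le_trans h.
by rewrite le_eqVlt; apply/orP; left; apply/eqP; field; rewrite !gt_eqF.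
Qed.

Lemma far_small e : 0 < e -> \forall r \near +oo, 0 < r /\ B / A / mass r <= e.
Proof.
move=> e0; pose k := B ^+ 3 / A.
have k0 : 0 < k by rewrite divr_gt0 // exprn_gt0.
near=> r.
have r1 : 1 <= r by near: r; exact: nbhs_pinfty_ge.
have r0 : 0 < r by exact: lt_le_trans r1.
have rk : k / e <= r by near: r; apply: nbhs_pinfty_ge; exact: num_real.
split => //; apply: (le_trans (far_bound r0)); rewrite -/k.
rewrite ler_pdivrMr ?exprn_gt0 // mulrC -ler_pdivrMr //.
by apply: (le_trans rk); rewrite expr2 ler_peMr // ltW.
Unshelve. all: by end_near. Qed.

Lemma mass_gt0 r : 0 < r -> 0 < mass r.
Proof.
move=> r0; apply: lt_le_trans (mass_lb (ltW r0)).
by rewrite divr_gt0 // exprn_gt0.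
Qed.

Lemma cbar_pinfty : cbar r @[r --> +oo] --> int01 g.
Proof.
apply/cvgrPdist_le => e e0; near=> r.
have [r0 re] : 0 < r /\ B / A / mass r <= e by near: r; exact: far_small.
rewrite distrC; apply: le_trans re.
by have [_ h] := wave_far (mass_gt0 r0); exact: h.
Unshelve. all: by end_near. Qed.

(** The profile is the inverse function of [c * H], where [H' = 1 / V]. *)
Lemma profile_exists p : exists chi, profile g p (cbar (enorm p)) chi.
Proof.
set a := enorm p; have a0 : 0 <= a by exact: enorm_ge0.
set m := mass a; set c := cbar a.
have [m0 mE] := massP a0; rewrite -/m -/c in m0 mE.
have [pV cV V0 dV] := wave_ofP m0.
have c0 : 0 < c by exact: cbar_gt0.
have [H dH HE] := int01_primitive (continuous_inv cV V0).
have Jc : H 1 - H 0 = c^-1 by rewrite -HE /c /cbar /speed invrK.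
have HS x : H (x + 1) - H x = H (0 + 1) - H 0.
  by apply: (periodic_primitive _ _ dH) => y; rewrite pV.
have Hmono : {homo H : x y / x < y}.
  by apply: (deriv_gt0_homo dH) => x; rewrite invr_gt0.
have Hinj : injective H.
  move=> x y E; apply/le_anti/andP; split; rewrite leNgt; apply/negP => /Hmono;
  by rewrite E ltxx.
have slope x y : x <= y -> (y - x) / B <= H y - H x.
  move=> xy; have [k _ ->] := mean_value xy dH.
  rewrite mulrC ler_wpM2r ?subr_ge0 // lef_pV2 ?posrE //.
  exact: (wave_of_le _ m0).
have Hsurj t : exists x, H x = t.
  pose Y := B * `|t - H 0|; have Y0 : 0 <= Y by rewrite mulr_ge0 // ltW.
  have YY : - Y <= Y by lra.
  have [||x _ <-] := @IVT R H (- Y) Y t YY; last by exists x.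
    exact/continuous_subspaceT/(hd_continuous dH).
  have YB : Y / B = `|t - H 0| by rewrite /Y; field; rewrite gt_eqF.
  have NY : - Y <= 0 by lra.
  have h1 := slope _ _ Y0; have h2 := slope _ _ NY.
  rewrite subr0 YB in h1; rewrite sub0r opprK YB in h2.
  have h3 := ler_norm (t - H 0); have h4 := ler_norm (- (t - H 0)).
  rewrite normrN in h4.
  by rewrite ge_min le_max; apply/andP; split; apply/orP; [left|right]; lra.
have /choice[chi chiE] : forall z, exists y, H y = z / c by move=> z; exact: Hsurj.
have chiK y : chi (c * H y) = y.
  by apply: Hinj; rewrite chiE mulrC mulKf // gt_eqF.
have dchi z : has_deriv chi z (V m (chi z) / c).
  have E : c * H (chi z) = z by rewrite chiE mulrC divfK // gt_eqF.
  have dcH y : has_deriv (fun y => c * H y) y (c * (V m y)^-1) by exact: hdZ.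
  have /(_ _ _ _ _) D := @is_derive_inverse R (fun y => c * H y) chi (c * (V m (chi z))^-1) (chi z).
  rewrite E in D; apply: hd_eq; first apply: D.
  - by near=> y; exact: chiK.
  - by near=> y; apply: hd_continuous_at; exact: dcH.
  - exact: dcH.
  - by apply: lt0r_neq0; exact: divr_gt0.
  - by rewrite invf_div.
have cS z : chi (z + 1) = chi z + 1.
  apply: Hinj; rewrite chiE; have := HS (chi z); rewrite add0r Jc chiE => E.
  by rewrite mulrDl mul1r; lra.
have d1 : derive1 chi = fun z => V m (chi z) / c.
  by apply/funext => z; exact: hd_derive1.
exists chi; split => //; last first.
  apply: (deriv_ge0_homo dchi) => z.
  by rewrite divr_ge0 ?(ltW c0) ?(ltW (V0 _)).
split.
- move=> z _; split.
  + by have [] := dchi z.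
  + move=> p0; have ma : 0 < m.
      by apply: mass_gt0; rewrite lt0r a0 enorm_eq0 p0.
    rewrite d1; have D := wave_deriv (chi z) ma (wave_ofP m0).
    have [] // : has_deriv (fun z => V m (chi z) / c) z
       ((V m (chi z) - g (chi z)) / (m * V m (chi z)) * (V m (chi z) / c) * c^-1 +
         V m (chi z) * 0).
    by apply: hdM; [exact: (hd_comp D (dchi z))|exact: hd_cst].
  + have [p0|p0] := eqVneq p 0.
      have az : a = 0 by apply/eqP; rewrite enorm_eq0 p0.
      rewrite -/a az expr0n mulr0 d1 /m az mass0 (wave_of0).
      by field; rewrite gt_eqF.
    have ma : 0 < m by apply: mass_gt0; rewrite lt0r a0 enorm_eq0 p0.
    have D := wave_deriv (chi z) ma (wave_ofP m0).
    have D2 : has_deriv (derive1 chi) z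
       ((V m (chi z) - g (chi z)) / (m * V m (chi z)) * (V m (chi z) / c) * c^-1 +
         V m (chi z) * 0).
      by rewrite d1; apply: hdM; [exact: (hd_comp D (dchi z))|exact: hd_cst].
    rewrite (hd_derive1 D2) -/a -mE d1; field.
    by rewrite !gt_eqF.
- by have := cS 0; rewrite add0r.
- exists (V m (chi 0) / c).
  have lim z : h^-1 * (chi (z + h) - chi z) @[h --> 0^'] --> V m (chi z) / c.
    have [D <-] := dchi z; rewrite /derivable in D.
    rewrite /derive; move: D.
    have -> : (fun h => h^-1 *: ((chi \o shift z) (h *: (1 : R)) - chi z)) =
        (fun h : R => h^-1 * (chi (z + h) - chi z)).
      by apply/funext => h /=; rewrite /GRing.scale /= mulr1 (addrC z).
    by [].
  split.
    rewrite (_ : (fun h : R => _) = (fun h => h^-1 * (chi (0 + h) - chi 0))).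
      exact: cvg_dnbhs_at_right (lim 0).
    by apply/funext => h; rewrite add0r.
  have -> : V m (chi 0) = V m (chi 1) by rewrite -[1 in RHS]add0r cS pV.
  exact: cvg_dnbhs_at_left (lim 1).
Unshelve. all: by end_near. Qed.


(** Both profiles advance at unit rate in the flow time [H]; the shift makes their
times agree at 0. *)
Lemma profile_translate p chi1 chi2 c : profile g p c chi1 -> profile g p c chi2 ->
  exists k, forall z, chi2 z = chi1 (z + k).
Proof.
move=> /(profile_flow)[c0 _ d1] /(profile_flow)[_ _ d2].
have [m0 _] := massP (enorm_ge0 p).
have [pV cV V0 dV] := wave_ofP m0.
have [H dH] := continuous_primitive (continuous_inv cV V0).
have t1 := flow_time _ V0 dH d1; have t2 := flow_time _ V0 dH d2.
have Hmono : {homo H : x y / x < y}.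
  by apply: (deriv_gt0_homo dH) => x; rewrite invr_gt0.
exists (c * (H (chi2 0) - H (chi1 0))) => z.
have E : H (chi2 z) = H (chi1 (z + c * (H (chi2 0) - H (chi1 0)))).
  by rewrite t1 t2; field; rewrite gt_eqF.
by apply/le_anti/andP; split; rewrite leNgt; apply/negP => /Hmono; rewrite E ltxx.
Qed.

(** Two primitives along the flow: [c chi - m c V(chi)] for [g (chi)], and
[m V(chi)^2 / 2 + G (chi)] for [c chi'^2], where [G' = g]. *)
Lemma profile_integrals p chi : p != 0 -> profile g p (cbar (enorm p)) chi ->
  cbar (enorm p) = int01 (fun z => g (chi z)) /\
  int01 (fun z => g (chi z)) = int01 g / int01 (fun z => derive1 chi z ^+ 2).
Proof.
move=> p0 hp; have [_ _ cS] := hp.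
have [c0 _ dchi] := profile_flow hp.
set c := cbar _ in hp c0 dchi *.
have [m0 mE] := massP (enorm_ge0 p).
have m_gt0 : 0 < mass (enorm p).
  by apply: (mass_gt0); rewrite lt0r enorm_ge0 enorm_eq0 p0.
set m := mass _ in m0 mE m_gt0 dchi.
have wV := wave_ofP m0; have [pV cV V0 dV] := wV.
have cchi := hd_continuous dchi.
have c10 : chi 1 = chi 0 + 1 by have := cS 0; rewrite add0r.
have d1 : derive1 chi = fun z => V m (chi z) / c.
  by apply/funext => z; exact: hd_derive1.
have I1 : int01 (fun z => g (chi z)) = c.
  rewrite /int01 (@Rint01E _ (fun z => c * chi z - m * c * V m (chi z))).
  - by rewrite c10 pV; ring.
  - by move=> z; apply: (@continuous_comp _ _ _ chi g); [exact: cchi|exact: cg].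
  move=> z; apply: hd_eq.
    apply: hdB; first exact: hdZ (dchi z).
    by apply: hdZ; exact: (hd_comp (wave_deriv (chi z) m_gt0 wV) (dchi z)).
  by field; rewrite !gt_eqF.
have [G dG GE] := int01_primitive cg.
have GS x : G (x + 1) - G x = G (0 + 1) - G 0 := periodic_primitive x 0 dG pg.
have cd2 : continuous (fun z => derive1 chi z ^+ 2).
  rewrite d1 => z; apply: (@continuous_sqr_at R (fun z => V m (chi z) / c)).
  apply: cvgM; last exact: cvg_cst.
  by apply: (@continuous_comp _ _ _ chi (V m)); [exact: cchi|exact: cV].
have I2 : c * int01 (fun z => derive1 chi z ^+ 2) = int01 g.
  rewrite -int01Z // GE /int01 (@Rint01E _ (fun z => m / 2 * V m (chi z) ^+ 2 + G (chi z))).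
  - by rewrite c10 pV; have := GS (chi 0); rewrite add0r; lra.
  - by move=> z; apply: cvgM; [exact: cvg_cst|exact: cd2].
  move=> z; apply: hd_eq.
    apply: hdD; last exact: hd_comp (dG (chi z)) (dchi z).
    exact: (@hd_comp R (fun x => m / 2 * V m x ^+ 2) chi z _ _ (dV (chi z)) (dchi z)).
  by rewrite d1; field; rewrite gt_eqF.
have Ig : 0 < int01 g.
  by apply: (lt_le_trans A0); case/andP: (int01_between cg gAB).
split; first by rewrite I1.
rewrite I1 -I2 mulfK //; apply/eqP => I0; move: Ig.
by rewrite -I2 I0 mulr0 ltxx.
Qed.

(** Measured in the flow time [H] of the limit profile, [chi] advances at a rate
which differs from [1 / cbar 0] by [O(|p|^2)]; this controls one period, and
[chi - chi0] is periodic. *)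
Lemma profile_near0 : exists K, forall p chi chi0,
  profile g p (cbar (enorm p)) chi ->
  profile g (0 : 'rV[R]_n) (cbar 0) chi0 ->
  forall z, `|chi z - chi0 z| <= K * (enorm p ^+ 2 + `|chi 0 - chi0 0|).
Proof.
have [K cK] := cbar_near0.
pose k := (A ^- 2 * B * L * B + B * K) / A ^+ 3.
exists (B * (`|k| + A^-1)) => p chi chi0 hp h0.
set a := enorm p; have a_ge0 : 0 <= a by exact: enorm_ge0.
have [_ _ cS] := hp; have [_ _ c0S] := h0.
have [c_gt0 _ dchi] := profile_flow hp.
have [c0_gt0 _] := profile_flow h0.
have -> : enorm (0 : 'rV[R]_n) = 0 by apply/eqP; rewrite enorm_eq0.
rewrite (mass0) (wave_of0) => dchi0.
rewrite -/a in c_gt0 dchi *.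
have /andP[cA _] := cbar_bounds a_ge0.
have /andP[c0A c0B] := cbar_bounds (lexx 0).
have cc0 := cK _ a_ge0.
set c := cbar a in c_gt0 dchi cA cc0 *; set c0 := cbar 0 in c0_gt0 dchi0 c0A c0B cc0 *.
have [m0 _] := massP a_ge0.
have mU := mass_ub a_ge0.
set m := mass a in m0 mU dchi *.
have [H dH] := continuous_primitive (continuous_inv cg g0).
have t0 := flow_time _ g0 dH dchi0.
have slope x y : `|x - y| <= B * `|H x - H y|.
  wlog xy : x y / y <= x => [hw|].
    by case: (leP y x) => [/hw//|/ltW/hw]; rewrite distrC (distrC (H x)).
  have [w _ ->] := mean_value xy dH.
  rewrite normrM mulrA ler_peMl // ger0_norm ?invr_ge0 ?(ltW (g0 _)) //.
  by rewrite ler_pdivlMr // mul1r; case/andP: (gAB w).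
have lipH x y : `|H x - H y| <= A^-1 * `|x - y|.
  apply: (deriv_le_bound _ _ dH) => w.
  rewrite ger0_norm ?invr_ge0 ?(ltW (g0 _)) // lef_pV2 ?posrE //.
  by case/andP: (gAB w).
(* The rate of [H] along [chi], compared with that along [chi0]. *)
have drift z : `|(g (chi z))^-1 * (V m (chi z) / c) - c0^-1| <= k * a ^+ 2.
  set v := V m (chi z); set w := g (chi z).
  have w_gt0 : 0 < w by exact: g0.
  have /andP[wA wB] : A <= w <= B by exact: gAB.
  have vw : `|v - w| <= m * B * L by exact: (wave_near0).
  have -> : w^-1 * (v / c) - c0^-1 = ((v - w) * c0 + w * (c0 - c)) / (w * c * c0).
    by field; rewrite !gt_eqF.
  rewrite normrM normfV (gtr0_norm (x := w * c * c0)) ?mulr_gt0 //.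
  have kE : k * a ^+ 2 = (a ^+ 2 / A ^+ 2 * B * L * B + B * (K * a ^+ 2)) / A ^+ 3.
    by rewrite /k; field; rewrite gt_eqF.
  have wcc : 0 < w * c * c0 by rewrite !mulr_gt0.
  rewrite kE; apply: ler_pM; rewrite ?normr_ge0 ?invr_ge0 ?(ltW wcc) //.
    apply: (le_trans (ler_normD _ _)); apply: lerD.
      rewrite normrM (gtr0_norm c0_gt0); apply: ler_pM; rewrite ?normr_ge0 ?(ltW c0_gt0) //.
      apply: (le_trans vw); rewrite -(mulrA m) -(mulrA (a ^+ 2 / A ^+ 2) B).
      apply: ler_wpM2r => //.
      by rewrite mulr_ge0 // ltW.
    rewrite normrM (gtr0_norm w_gt0) (distrC c0); apply: ler_pM; rewrite ?(ltW w_gt0) //.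
  rewrite lef_pV2 ?posrE ?mulr_gt0 ?exprn_gt0 // exprSr expr2.
  apply: ler_pM; rewrite ?mulr_ge0 ?(ltW A0) //.
  by apply: ler_pM; rewrite ?(ltW A0).
have dHchi z : has_deriv (fun z => H (chi z) - c0^-1 * z) z
    ((g (chi z))^-1 * (V m (chi z) / c) - c0^-1).
  apply: hd_eq; first apply: hdB.
  - exact: hd_comp (dH (chi z)) (dchi z).
  - exact: hdZ (hd_id z).
  - by rewrite mulr1.
have unit z : 0 <= z <= 1 ->
    `|chi z - chi0 z| <= B * (`|k| + A^-1) * (a ^+ 2 + `|chi 0 - chi0 0|).
  move=> /andP[z0 z1]; apply: (le_trans (slope _ _)).
  rewrite -mulrA ler_wpM2l ?(ltW B0) //.
  have D := deriv_le_bound 0 z dHchi drift.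
  have ka : k * a ^+ 2 <= `|k| * a ^+ 2 by rewrite ler_wpM2r ?sqr_ge0 // ler_norm.
  have hk : k * a ^+ 2 * `|z - 0| <= `|k| * a ^+ 2.
    rewrite subr0 (ger0_norm z0).
    have h1 : `|k| * a ^+ 2 * z <= `|k| * a ^+ 2.
      by rewrite ler_piMr // mulr_ge0 ?sqr_ge0.
    by apply: le_trans h1; rewrite ler_wpM2r.
  have h0' := lipH (chi 0) (chi0 0).
  have -> : H (chi z) - H (chi0 z) =
      (H (chi z) - c0^-1 * z - (H (chi 0) - c0^-1 * 0)) + (H (chi 0) - H (chi0 0)).
    by rewrite t0; ring.
  apply: (le_trans (ler_normD _ _)).
  have h3 : 0 <= `|k| * `|chi 0 - chi0 0| by rewrite mulr_ge0.
  have h4 : 0 <= A^-1 * a ^+ 2 by rewrite mulr_ge0 ?sqr_ge0 // invr_ge0 ltW.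
  have := le_trans D hk; lra.
move=> z; have [l /andP[l0 l1]] := unit_repr z.
have pe : periodic (fun z => chi z - chi0 z) 1 by move=> x; rewrite cS c0S; ring.
have := periodic_int (z - l%:~R) l pe; rewrite subrK /= => ->.
by apply: unit; rewrite l0 ltW.
Qed.

(** [chi'] is the quotient of [V (chi)] by the speed, and by [wave_far] both are
close to the mean of [g]. *)
Lemma profile_far p chi : p != 0 -> profile g p (cbar (enorm p)) chi ->
  let e := 2 * (B / A / mass (enorm p)) / A in
  forall z, `|derive1 chi z - 1| <= e /\ `|chi z - z| <= e + `|chi 0|.
Proof.
move=> p0 hp; have [_ _ cS] := hp.
have [c_gt0 _ dchi] := profile_flow hp.
have a0 : 0 < enorm p by rewrite lt0r enorm_ge0 enorm_eq0 p0.
have m_gt0 : 0 < mass (enorm p) by exact: mass_gt0 _ a0.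
have /andP[cA _] := cbar_bounds (ltW a0).
have [vI cI] := wave_far m_gt0.
rewrite -/(cbar (enorm p)) in cI.
set c := cbar _ in cI c_gt0 dchi cA; set m := mass _ in vI m_gt0 dchi cI *.
move=> e.
have e0 : 0 <= e by rewrite /e !(divr_ge0, mulr_ge0) // ltW.
have d1 z : `|V m (chi z) / c - 1| <= e.
  have -> : V m (chi z) / c - 1 = (V m (chi z) - c) / c by field; rewrite gt_eqF.
  rewrite normrM normfV (gtr0_norm c_gt0); apply: ler_pM => //.
  - by rewrite ltW // invr_gt0.
  - rewrite (_ : V m (chi z) - c = (V m (chi z) - int01 g) - (c - int01 g)); last by ring.
    by apply: (le_trans (ler_normB _ _)); have := vI (chi z); lra.
  - by rewrite lef_pV2 ?posrE.
have dz z : has_deriv (fun z => chi z - z) z (V m (chi z) / c - 1).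
  by apply: hdB; [exact: dchi|exact: hd_id].
move=> z; split; first by rewrite (hd_derive1 (dchi z)).
have [l /andP[l0 l1]] := unit_repr z.
have pe : periodic (fun z => chi z - z) 1 by move=> x; rewrite cS; ring.
have := periodic_int (z - l%:~R) l pe; rewrite subrK /= => ->.
set y := z - _ in l0 l1 *.
have D := deriv_le_bound 0 y dz d1.
have ey : e * `|y - 0| <= e by rewrite subr0 ger0_norm // ler_piMr // ltW.
rewrite (_ : chi y - y = (chi y - y - (chi 0 - 0)) + chi 0); last by ring.
by apply: (le_trans (ler_normD _ _)); rewrite lerD2r (le_trans D).
Qed.

End waves_and_profiles.

(** * Convergence in the norm of p *)

Section uniform_limits.
Context {R : realType} (n : nat).
Implicit Types (F : set_system R) (X : 'rV[R]_n -> R -> R) (f : R -> R).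

Lemma cvg_uniform_enorm F X f : Filter F ->
  (forall e, 0 < e -> \forall r \near F, forall p, enorm p = r ->
    forall z, `|X p z - f z| <= e) ->
  {uniform, X p @[p --> enorm_to F] --> f}.
Proof.
move=> FF hX P /uniform_nbhs[E [entE EP]].
move: entE; rewrite -entourage_ballE => -[e /= e0 eE].
have e2 : 0 < e / 2 by rewrite divr_gt0.
apply: filterS (hX _ e2) => r hr p pr; apply: EP => y _; apply: eE => /=.
rewrite /ball /= distrC; apply: (le_lt_trans (hr p pr y)).
by rewrite ltr_pdivrMr // mulr_natr mulr2n ltrDl.
Qed.

End uniform_limits.

Theorem theorem4p1 (R : realType) (n : nat) (g : R -> R)
    (n_gt0 : (0 < n)%N)
    (g_lip : lipschitz g)
    (g_per : forall (y : R) (k : int), g (y + k%:~R) = g y)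
    (g_gt0 : forall y, 0 < g y) :
  let mu := @lebesgue_measure R in
  exists cbar : R -> R,
    (forall p : 'rV[R]_n,
       unique (fun c => exists chi, profile g p c chi) (cbar (enorm p)))
    /\ (forall (p : 'rV[R]_n) chi1 chi2,
          profile g p (cbar (enorm p)) chi1 ->
          profile g p (cbar (enorm p)) chi2 ->
          exists k : R, forall z, chi2 z = chi1 (z + k))
    /\ {within [set r | 0 <= r], continuous cbar}
    /\ (forall r s, 0 <= r -> r <= s -> cbar r <= cbar s)
    /\ (forall r, 0 <= r -> 0 < cbar r)
    /\ (forall (p : 'rV[R]_n) chi, p != 0 ->
          profile g p (cbar (enorm p)) chi ->
          cbar (enorm p) = \int[mu]_(z in `[0, 1]) g (chi z) /\
          \int[mu]_(z in `[0, 1]) g (chi z) =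
            (\int[mu]_(s in `[0, 1]) g s)
            / \int[mu]_(z in `[0, 1]) (derive1 chi z ^+ 2))
    /\ cbar 0 = (\int[mu]_(s in `[0, 1]) (g s)^-1)^-1
    /\ cbar r @[r --> 0^'+] --> (\int[mu]_(s in `[0, 1]) (g s)^-1)^-1
    /\ (forall (X : 'rV[R]_n -> R -> R) (chi0 : R -> R),
          (forall p, profile g p (cbar (enorm p)) (X p)) ->
          profile g (0 : 'rV[R]_n) (cbar 0) chi0 ->
          X p 0 @[p --> enorm_to 0^'+] --> chi0 0 ->
          {uniform, X p @[p --> enorm_to 0^'+] --> chi0})
    /\ cbar r @[r --> +oo] --> \int[mu]_(s in `[0, 1]) g s
    /\ (forall X : 'rV[R]_n -> R -> R,
          (forall p, profile g p (cbar (enorm p)) (X p)) ->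
          X p 0 @[p --> enorm_to +oo] --> (0 : R) ->
          {uniform, X p @[p --> enorm_to +oo] --> (fun z : R => z)} /\
          {uniform, derive1 (X p) @[p --> enorm_to +oo] --> (fun _ : R => 1 : R)})
    /\ ((~ exists a, forall y, g y = a) ->
          forall p : 'rV[R]_n,
            cbar (enorm p) < \int[mu]_(s in `[0, 1]) g s).
Proof.
move=> mu.
have pg : periodic g 1 by move=> y; have := g_per y 1; rewrite mulr1z.
have [L gL] : exists L, forall x y, `|g x - g y| <= L * `|x - y|.
  case: g_lip => M [_ hM]; exists (M + 1) => x y.
  by apply: (hM (M + 1) _ (x, y)); rewrite ?ltrDl.
have cg := lip_continuous gL.
have [xM mx] := periodic_argmax pg cg.
have [xm mn] := periodic_argmin pg cg.
have gA := g_gt0 xm.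
have gAB x : g xm <= g x <= g xM by rewrite mn mx.
exists (cbar g).
have en0 : enorm (0 : 'rV[R]_n) = 0 by apply/eqP; rewrite enorm_eq0.
repeat apply: conj.
- move=> p; split; first exact: profile_exists pg gL gAB gA p.
  by move=> c [chi /(profile_flow pg gL gAB gA)[_ ->]].
- by move=> p chi1 chi2; exact: (profile_translate pg gL gAB gA).
- exact: cbar_continuous pg gL gAB gA.
- by move=> r s; exact: (cbar_le pg gL gAB gA).
- by move=> r; exact: (cbar_gt0 pg gL gAB gA).
- by move=> p chi; exact: (profile_integrals pg gL gAB gA).
- exact: cbar0 pg gL gAB gA.
- by have := cbar_right0 pg gL gAB gA; rewrite (cbar0 pg gL gAB gA).
- move=> X chi0 hX h0 hX0.
  have [K hK] := @profile_near0 R n _ _ _ _ pg gL gAB gA.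
  apply: cvg_uniform_enorm => e e0.
  have K1 : 0 < 2 * (`|K| + 1) by rewrite mulr_gt0 // ltr_wpDl.
  set d := e / (2 * (`|K| + 1)).
  have d0 : 0 < d by exact: divr_gt0.
  have X0 : \forall r \near 0^'+, forall p : 'rV[R]_n, enorm p = r ->
      ball (chi0 0) d (X p 0) := hX0 _ (nbhsx_ballx _ _ d0).
  near=> r => p pr z.
  have r0 : 0 <= r by near: r; exact: nbhs_right_ge.
  have r1 : r <= 1 by near: r; exact: nbhs_right_le.
  have rd : r <= d by near: r; exact: nbhs_right_le.
  have : ball (chi0 0) d (X p 0) by move: p pr; near: r; exact: X0.
  rewrite /ball /= distrC => /ltW Xd.
  apply: (le_trans (hK _ _ _ (hX p) h0 z)); rewrite pr.
  have r2 : r ^+ 2 <= d by rewrite (le_trans _ rd) // expr2 ler_piMr.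
  have t0 : 0 <= r ^+ 2 + `|X p 0 - chi0 0| by rewrite addr_ge0 ?sqr_ge0.
  have K2 : K <= `|K| + 1 by rewrite (le_trans (ler_norm _)) // lerDl.
  apply: (le_trans (ler_wpM2r t0 K2)).
  apply: (@le_trans _ _ ((`|K| + 1) * (d + d))).
    by rewrite ler_wpM2l ?lerD // addr_ge0.
  rewrite le_eqVlt; apply/orP; left; apply/eqP; rewrite /d; field.
  by rewrite gt_eqF // ltr_wpDl.
- exact: cbar_pinfty pg gL gAB gA.
- move=> X hX hX0.
  have far e : 0 < e -> \forall r \near +oo, forall p : 'rV[R]_n, enorm p = r ->
      forall z, `|derive1 (X p) z - 1| <= e /\ `|X p z - z| <= e + `|X p 0|.
    move=> e0; have ge0 : 0 < g xm * e / 2 by rewrite divr_gt0 // mulr_gt0.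
    near=> r => p pr z.
    have [r0 rm] : 0 < r /\ g xM / g xm / mass g r <= g xm * e / 2.
      by near: r; exact: (far_small pg gL gAB gA ge0).
    have p0 : p != 0 by rewrite -enorm_eq0 pr gt_eqF.
    have := profile_far pg gL gAB gA p0 (hX p) z; rewrite /= pr.
    set u := 2 * _ / _ => -[h1 h2].
    have ue : u <= e by rewrite /u ler_pdivrMr //; lra.
    split; first exact: le_trans ue.
    by apply: (le_trans h2); rewrite lerD2r.
  split; apply: cvg_uniform_enorm => e e0.
    have e2 : 0 < e / 2 by rewrite divr_gt0.
    have X0 : \forall r \near +oo, forall p : 'rV[R]_n, enorm p = r ->
      ball (0 : R) (e / 2) (X p 0) := hX0 _ (nbhsx_ballx _ _ e2).
    apply: filterS2 (far _ e2) X0 => r h1 h2 p pr z.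
    have [_ h3] := h1 p pr z; apply: (le_trans h3).
    by have := h2 p pr; rewrite /ball /= sub0r normrN; lra.
  by apply: filterS (far _ e0) => r h1 p pr z; have [] := h1 p pr z.
- move=> ng p; apply: (speed_lt_mean pg gL gAB gA ng).
  exact: (mass_ge0 pg gL gAB gA (enorm_ge0 p)).
Unshelve. all: by end_near. Qed.
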